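(* Let $\mathscr{D}$ be a triangulated category over a base field $\mathbf{k}$ (with the standing assumptions listed in the context), let $F\colon\mathscr{D}\to\mathscr{D}$ be an endofunctor, let $G$ be a split generator of $\mathscr{D}$, and let $\mathscr{A}\subseteq\mathscr{D}$ be the heart of a bounded $t$-structure on $\mathscr{D}$. Then the limit $$\lim_{n\to\infty}\frac{\phi^+_{\mathscr{A}}(F^nG)}{n}$$ exists and is independent of the choices of the split generator $G$ and of the heart $\mathscr{A}$ (and therefore gives an invariant of $F$). Moreover, if $\mathscr{D}$ admits a Serre functor, then the limit $$\lim_{n\to\infty}\frac{\phi^-_{\mathscr{A}}(F^nG)}{n}$$ also exists and is independent of the choices of $G$ and $\mathscr{A}$.
   Context: Standing assumptions. All triangulated categories are $\mathbb{Z}$-graded, linear over a base field $\mathbf{k}$, saturated (i.e. they admit a dg-enhancement which is smooth and proper), and of finite type (i.e. $\bigoplus_{k\in\mathbb{Z}}\operatorname{Hom}_{\mathscr{D}}(E,E'[k])$ is a finite-dimensional $\mathbf{k}$-vector space for all objects $E,E'$ of $\mathscr{D}$). Endofunctors are $\mathbf{k}$-linear, triangulated, and not virtually zero (i.e. no power is the zero functor). Hearts. A full additive subcategory $\mathscr{A}\subseteq\mathscr{D}$ is the heart of a bounded $t$-structure on $\mathscr{D}$ if and only if: (a) $\operatorname{Hom}_{\mathscr{D}}(A_1[k_1],A_2[k_2])=0$ whenever $k_1>k_2$ are integers and $A_1,A_2\in\mathscr{A}$; (b) for every nonzero object $E$ of $\mathscr{D}$ there is a (unique) sequence of morphisms $0=E_0\to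 E_1\to\cdots\to E_m=E$ which fit into exact triangles $E_{i-1}\to E_i\to A_i[k_i]\to E_{i-1}[1]$ for $1\le i\le m$, with integers $k_1>\cdots>k_m$ and (nonzero) objects $A_1,\dots,A_m$ of $\mathscr{A}$. A bounded $t$-structure is determined by its heart. For a nonzero object $E$ with the sequence in (b), define $\phi^+_{\mathscr{A}}(E):=k_1$ and $\phi^-_{\mathscr{A}}(E):=k_m$. Split generator. An object $G$ of $\mathscr{D}$ is a split generator if for every object $E$ of $\mathscr{D}$ there are an object $E'$ of $\mathscr{D}$ and a finite sequence $0=B_0\to B_1\to\cdots\to B_m\cong E\oplus E'$ such that $\operatorname{Cone}(B_{\ell-1}\to B_\ell)\cong G[k_\ell]$ for some integer $k_\ell$, for each $\ell=1,\dots,m$. *)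

(* Defs.v *)
From HB Require Import structures.
From mathcomp Require Import all_boot all_order all_algebra.
From mathcomp Require Import all_classical all_reals all_analysis.

Set Implicit Arguments.
Unset Strict Implicit.
Unset Printing Implicit Defensive.

Import Order.TTheory GRing.Theory Num.Theory.
Local Open Scope ring_scope.

Definition fin_dim (k : fieldType) (V : lmodType k) : Prop :=
  exists n (e : 'I_n -> V), forall v, exists c : 'I_n -> k,
    v = \sum_i c i *: e i.

Definition bilin (k : fieldType) (U V W : lmodType k) (b : U -> V -> W) : Prop :=
  (forall v, linear (fun u => b u v)) /\ (forall u, linear (b u)).

(* [t] exhibits [T] as the tensor product of [U] and [V] over [k]. *)
Definition is_tensor (k : fieldType) (U V T : lmodType k) (t : U -> V -> T) : Prop :=
  bilin t /\
  forall (W : lmodType k) (b : U -> V -> W), bilin b ->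
    exists g : {linear T -> W}, (forall u v, g (t u v) = b u v) /\
      forall g' : {linear T -> W}, (forall u v, g' (t u v) = b u v) -> g' =1 g.

Record lincat (k : fieldType) := LinCat {
  ob :> Type;
  hom : ob -> ob -> lmodType k;
  idm : forall X, hom X X;
  mcomp : forall X Y Z, hom Y Z -> hom X Y -> hom X Z;
  comp_bilin : forall X Y Z, bilin (@mcomp X Y Z);
  compA : forall X Y Z W (h : hom Z W) (g : hom Y Z) (f : hom X Y),
    mcomp h (mcomp g f) = mcomp (mcomp h g) f;
  comp1m : forall X Y (f : hom X Y), mcomp (idm Y) f = f;
  compm1 : forall X Y (f : hom X Y), mcomp f (idm X) = f }.

Arguments hom {k} C X Y : rename.
Arguments idm {k C} X : rename.
Arguments mcomp {k C X Y Z} g f : rename.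

Notation "g \c f" := (mcomp g f) (at level 40, left associativity).

Definition is_iso (k : fieldType) (C : lincat k) (X Y : C) (f : hom C X Y) : Prop :=
  exists g : hom C Y X, g \c f = idm X /\ f \c g = idm Y.

Definition isomorphic (k : fieldType) (C : lincat k) (X Y : C) : Prop :=
  exists f : hom C X Y, is_iso f.

Definition is_zero (k : fieldType) (C : lincat k) (Z : C) : Prop :=
  forall X, (forall f : hom C X Z, f = 0) /\ (forall f : hom C Z X, f = 0).

Definition is_biproduct (k : fieldType) (C : lincat k) (X Y B : C) : Prop :=
  exists (i : hom C X B) (j : hom C Y B) (p : hom C B X) (q : hom C B Y),
    [/\ p \c i = idm X, q \c j = idm Y, p \c j = 0, q \c i = 0
      & i \c p + j \c q = idm B].

Definition additive_cat (k : fieldType) (C : lincat k) : Prop :=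
  (exists Z : C, is_zero Z) /\ (forall X Y : C, exists B, is_biproduct X Y B).

Record linfunctor (k : fieldType) (C D : lincat k) := LinFunctor {
  fob :> C -> D;
  fhom : forall X Y, {linear hom C X Y -> hom D (fob X) (fob Y)};
  fhom1 : forall X, fhom X X (idm X) = idm (fob X);
  fhom_comp : forall X Y Z (g : hom C Y Z) (f : hom C X Y),
    fhom X Z (g \c f) = fhom Y Z g \c fhom X Y f }.

Arguments fhom {k C D} F {X Y} : rename.

Definition id_functor (k : fieldType) (C : lincat k) : linfunctor C C :=
  @LinFunctor k C C (fun X => X) (fun X Y => idfun)
    (fun X => erefl) (fun X Y Z g f => erefl).

Program Definition comp_functor (k : fieldType) (C D E : lincat k)
    (G : linfunctor D E) (F : linfunctor C D) : linfunctor C E :=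
  @LinFunctor k C E (fun X => G (F X))
    (fun X Y => (fhom G \o fhom F : {linear _ -> _})) _ _.
Next Obligation. by move=> *; rewrite /= !fhom1. Qed.
Next Obligation. by move=> *; rewrite /= !fhom_comp. Qed.

Definition nat_iso (k : fieldType) (C D : lincat k) (F G : linfunctor C D) : Prop :=
  exists t : forall X, hom D (F X) (G X),
    (forall X, is_iso (t X)) /\
    (forall X Y (f : hom C X Y), t Y \c fhom F f = fhom G f \c t X).

Definition quasi_inverse (k : fieldType) (C D : lincat k)
    (F : linfunctor C D) (G : linfunctor D C) : Prop :=
  nat_iso (comp_functor G F) (id_functor C) /\
  nat_iso (comp_functor F G) (id_functor D).

(* The translation functor is an autoequivalence, with chosen quasi-inverse
   [unshift].  [distinguished f g h] means that X -f-> Y -g-> Z -h-> X[1] is a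
   distinguished triangle. *)
Record triangulated (k : fieldType) := Triangulated {
  tcat :> lincat k;
  tadditive : additive_cat tcat;
  shift1 : linfunctor tcat tcat;
  unshift1 : linfunctor tcat tcat;
  shift1K : quasi_inverse shift1 unshift1;
  distinguished : forall X Y Z : tcat,
    hom tcat X Y -> hom tcat Y Z -> hom tcat Z (shift1 X) -> Prop;
  exact_iso : forall (X Y Z X' Y' Z' : tcat)
      (f : hom tcat X Y) (g : hom tcat Y Z) (h : hom tcat Z (shift1 X))
      (f' : hom tcat X' Y') (g' : hom tcat Y' Z') (h' : hom tcat Z' (shift1 X'))
      (a : hom tcat X X') (b : hom tcat Y Y') (c : hom tcat Z Z'),
    is_iso a -> is_iso b -> is_iso c ->
    b \c f = f' \c a -> c \c g = g' \c b -> fhom shift1 a \c h = h' \c c ->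
    distinguished f g h -> distinguished f' g' h';
  exact_id : forall X Z : tcat, is_zero Z ->
    distinguished (idm X) (0 : hom tcat X Z) (0 : hom tcat Z (shift1 X));
  exact_cone : forall (X Y : tcat) (f : hom tcat X Y),
    exists Z (g : hom tcat Y Z) (h : hom tcat Z (shift1 X)), distinguished f g h;
  exact_rot : forall (X Y Z : tcat)
      (f : hom tcat X Y) (g : hom tcat Y Z) (h : hom tcat Z (shift1 X)),
    distinguished f g h <-> distinguished g h (- fhom shift1 f);
  exact_mor : forall (X Y Z X' Y' Z' : tcat)
      (f : hom tcat X Y) (g : hom tcat Y Z) (h : hom tcat Z (shift1 X))
      (f' : hom tcat X' Y') (g' : hom tcat Y' Z') (h' : hom tcat Z' (shift1 X'))
      (a : hom tcat X X') (b : hom tcat Y Y'),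
    distinguished f g h -> distinguished f' g' h' -> b \c f = f' \c a ->
    exists c : hom tcat Z Z',
      c \c g = g' \c b /\ fhom shift1 a \c h = h' \c c;
  exact_oct : forall (X Y Z U V W : tcat)
      (f : hom tcat X Y) (a : hom tcat Y U) (a' : hom tcat U (shift1 X))
      (g : hom tcat Y Z) (b : hom tcat Z V) (b' : hom tcat V (shift1 Y))
      (c : hom tcat Z W) (c' : hom tcat W (shift1 X)),
    distinguished f a a' -> distinguished g b b' -> distinguished (g \c f) c c' ->
    exists (u : hom tcat U W) (v : hom tcat W V),
      [/\ distinguished u v (fhom shift1 a \c b'),
          u \c a = c \c g, c' \c u = a',
          v \c c = b & b' \c v = fhom shift1 f \c c'] }.

Arguments shift1 {k D} : rename.
Arguments unshift1 {k D} : rename.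
Arguments distinguished {k D X Y Z} f g h : rename.

(* [tshift n E] is E[n]. *)
Definition tshift (k : fieldType) (D : triangulated k) (n : int) (E : D) : D :=
  match n with
  | Posz m => iter m (fob shift1) E
  | Negz m => iter m.+1 (fob unshift1) E
  end.

Record exact_functor (k : fieldType) (C D : triangulated k) := ExactFunctor {
  efun :> linfunctor C D;
  eshift : forall X : C, hom D (efun (shift1 X)) (shift1 (efun X));
  eshift_iso : forall X, is_iso (eshift X);
  eshift_nat : forall (X Y : C) (f : hom C X Y),
    eshift Y \c fhom efun (fhom shift1 f)
    = fhom shift1 (fhom efun f) \c eshift X;
  efun_exact : forall (X Y Z : C) (f : hom C X Y) (g : hom C Y Z)
      (h : hom C Z (shift1 X)),
    distinguished f g h ->
    distinguished (fhom efun f) (fhom efun g) (eshift X \c fhom efun h) }.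

Definition fpow (k : fieldType) (D : triangulated k) (F : exact_functor D D)
  (n : nat) (E : D) : D := iter n (fob F) E.

Definition not_virtually_zero (k : fieldType) (D : triangulated k)
    (F : exact_functor D D) : Prop :=
  forall n : nat, (0 < n)%N -> ~ (forall E : D, is_zero (fpow F n E)).

Definition finite_type (k : fieldType) (D : triangulated k) : Prop :=
  forall E E' : D,
    (forall n : int, fin_dim (hom D E (tshift n E'))) /\
    (exists N : nat, forall n : int, (N < `|n|)%N ->
       forall f : hom D E (tshift n E'), f = 0).

(* [eta E E'] is the isomorphism Hom(E, E') ~ Hom(E', S E)^*, natural in E
   and E'. *)
Definition is_serre (k : fieldType) (D : triangulated k)
    (S : linfunctor D D) : Prop :=
  (exists S' : linfunctor D D, quasi_inverse S S') /\
  exists eta : forall E E' : D, hom D E E' -> {scalar hom D E' (S E)},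
    [/\ forall (E E' : D) (a : k) (f g : hom D E E') x,
          eta E E' (a *: f + g) x = a * eta E E' f x + eta E E' g x,
        forall (E E' : D) (l : {scalar hom D E' (S E)}),
          exists f : hom D E E', eta E E' f =1 l /\
            forall f', eta E E' f' =1 l -> f' = f
      & forall (E1 E E' E1' : D) (a : hom D E1 E) (f : hom D E E')
          (b : hom D E' E1') (x : hom D E1' (S E1)),
          eta E1 E1' (b \c f \c a) x = eta E E' f (fhom S a \c x \c b)].

Definition has_serre (k : fieldType) (D : triangulated k) : Prop :=
  exists S : linfunctor D D, is_serre S.

(* A graded vector space is represented by its total space [cmod], the
   (internal) direct sum of the subspaces [hdeg n] of homogeneous elements of
   degree n; this avoids transports along equalities of degrees.  Differentials
   have degree +1. *)
Record complex (k : fieldType) := Complex {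
  cmod :> lmodType k;
  hdeg : int -> cmod -> Prop;
  dif : {linear cmod -> cmod};
  hdeg0 : forall n, hdeg n 0;
  hdegP : forall n (a : k) x y, hdeg n x -> hdeg n y -> hdeg n (a *: x + y);
  hdeg_span : forall x, exists (s : seq int) (y : int -> cmod),
    (forall n, hdeg n (y n)) /\ x = \sum_(n <- s) y n;
  hdeg_free : forall (s : seq int) (y : int -> cmod), uniq s ->
    (forall n, hdeg n (y n)) -> \sum_(n <- s) y n = 0 ->
    forall n, n \in s -> y n = 0;
  dif_deg : forall n x, hdeg n x -> hdeg (n + 1) (dif x);
  difK : forall x, dif (dif x) = 0 }.

Arguments hdeg {k} c n x : rename.
Arguments dif {k c} : rename.

Definition cocycle (k : fieldType) (V : complex k) (n : int) (x : V) : Prop :=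
  hdeg V n x /\ dif x = 0.

Definition coboundary (k : fieldType) (V : complex k) (n : int) (x : V) : Prop :=
  exists y, hdeg V (n - 1) y /\ x = dif y.

(* The total cohomology is finite-dimensional. *)
Definition proper_complex (k : fieldType) (V : complex k) : Prop :=
  exists m (e : 'I_m -> V), (forall i, dif (e i) = 0) /\
    forall x, dif x = 0 -> exists (c : 'I_m -> k) y,
      x = \sum_i c i *: e i + dif y.

Record chain_map (k : fieldType) (V W : complex k) (f : V -> W) : Prop :=
  ChainMap {
    chain_linear : linear f;
    chain_deg : forall n x, hdeg V n x -> hdeg W n (f x);
    chain_dif : forall x, f (dif x) = dif (f x) }.

Definition quasi_iso (k : fieldType) (V W : complex k) (f : V -> W) : Prop :=
  [/\ chain_map f,
      forall n y, cocycle n y -> exists2 x, cocycle n x & coboundary n (f x - y)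
    & forall n x, cocycle n x -> coboundary n (f x) -> coboundary n x].

Definition ksign (k : fieldType) (n : int) : k := (-1) ^+ `|n|%N.

Record dgcat (k : fieldType) := DgCat {
  dob :> Type;
  dhom : dob -> dob -> complex k;
  did : forall X, dhom X X;
  dcomp : forall X Y Z, dhom Y Z -> dhom X Y -> dhom X Z;
  dcomp_bilin : forall X Y Z, bilin (@dcomp X Y Z);
  dcompA : forall X Y Z W (h : dhom Z W) (g : dhom Y Z) (f : dhom X Y),
    dcomp h (dcomp g f) = dcomp (dcomp h g) f;
  dcomp1m : forall X Y (f : dhom X Y), dcomp (did Y) f = f;
  dcompm1 : forall X Y (f : dhom X Y), dcomp f (did X) = f;
  did_deg : forall X, cocycle 0 (did X);
  dcomp_deg : forall X Y Z m n (g : dhom Y Z) (f : dhom X Y),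
    hdeg (dhom Y Z) m g -> hdeg (dhom X Y) n f ->
    hdeg (dhom X Z) (m + n) (dcomp g f);
  dcomp_dif : forall X Y Z m (g : dhom Y Z) (f : dhom X Y),
    hdeg (dhom Y Z) m g ->
    dif (dcomp g f) = dcomp (dif g) f + ksign k m *: dcomp g (dif f) }.

Arguments dhom {k} C X Y : rename.
Arguments did {k C} X : rename.
Arguments dcomp {k C X Y Z} g f : rename.

Notation "g \dc f" := (dcomp g f) (at level 40, left associativity).

Definition proper_dg (k : fieldType) (C : dgcat k) : Prop :=
  forall X Y : C, proper_complex (dhom C X Y).

(* The triangle X -f-> Y -g-> Z -h-> X[1] of H^0(C) is isomorphic to the
   standard triangle on f.  The element [eta] gives a morphism
   (x, y) |-> g y + eta x from the cone of Hom(-,f), with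
   d(x, y) = (-dx, f x + dy), to Hom(-,Z); it has to be a quasi-isomorphism
   (the last two conjuncts), and its composite with [h] has to be homotopic to
   the projection (x, y) |-> x, a homotopy being (x, y) |-> beta y + alpha x. *)
Definition cone_triangle (k : fieldType) (C : dgcat k) (X Y Z : C)
    (f : dhom C X Y) (g : dhom C Y Z) (h : dhom C Z X) : Prop :=
  [/\ cocycle 0 f, cocycle 0 g & cocycle 1 h] /\
  exists (eta : dhom C X Z) (alpha : dhom C X X) (beta : dhom C Y X),
    [/\ hdeg (dhom C X Z) (-1) eta, hdeg (dhom C X X) (-1) alpha
      & hdeg (dhom C Y X) 0 beta] /\
    [/\ dif eta = g \dc f, dif beta = h \dc g
      & dif alpha = h \dc eta + beta \dc f - did X] /\
    forall (W : C) (n : int),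
      (forall z : dhom C W Z, cocycle n z ->
         exists (x : dhom C W X) (y : dhom C W Y),
           [/\ hdeg (dhom C W X) (n + 1) x, hdeg (dhom C W Y) n y,
               dif x = 0, f \dc x + dif y = 0
             & coboundary n (g \dc y + eta \dc x - z)]) /\
      (forall (x : dhom C W X) (y : dhom C W Y),
         hdeg (dhom C W X) (n + 1) x -> hdeg (dhom C W Y) n y ->
         dif x = 0 -> f \dc x + dif y = 0 ->
         coboundary n (g \dc y + eta \dc x) ->
         exists (x' : dhom C W X) (y' : dhom C W Y),
           [/\ hdeg (dhom C W X) n x', hdeg (dhom C W Y) (n - 1) y',
               x = - dif x' & y = f \dc x' + dif y']).

(* [Y] is X[1] in H^0(C). *)
Definition is_dg_shift (k : fieldType) (C : dgcat k) (X Y : C) : Prop :=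
  exists (u : dhom C X Y) (v : dhom C Y X),
    [/\ cocycle (-1) u, cocycle 1 v,
        coboundary 0 (v \dc u - did X) & coboundary 0 (u \dc v - did Y)].

Definition pretriangulated (k : fieldType) (C : dgcat k) : Prop :=
  [/\ inhabited C,
      forall X : C, exists Y, is_dg_shift X Y,
      forall Y : C, exists X, is_dg_shift X Y
    & forall (X Y : C) (f : dhom C X Y), cocycle 0 f ->
        exists Z (g : dhom C Y Z) (h : dhom C Z X), cone_triangle f g h].

(* [M X Y] is contravariant in X and covariant in Y, like Hom(X, Y). *)
Record dgbimod (k : fieldType) (C : dgcat k) := DgBimod {
  bimod :> C -> C -> complex k;
  lact : forall X Y Z, dhom C Y Z -> bimod X Y -> bimod X Z;
  ract : forall X Y Z, bimod Y Z -> dhom C X Y -> bimod X Z;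
  lact_bilin : forall X Y Z, bilin (@lact X Y Z);
  ract_bilin : forall X Y Z, bilin (@ract X Y Z);
  lactA : forall X Y Z W (b : dhom C Z W) (a : dhom C Y Z) (m : bimod X Y),
    lact b (lact a m) = lact (b \dc a) m;
  ractA : forall X Y Z W (m : bimod Z W) (b : dhom C Y Z) (a : dhom C X Y),
    ract (ract m b) a = ract m (b \dc a);
  lractA : forall X Y Z W (b : dhom C Z W) (m : bimod Y Z) (a : dhom C X Y),
    lact b (ract m a) = ract (lact b m) a;
  lact1 : forall X Y (m : bimod X Y), lact (did Y) m = m;
  ract1 : forall X Y (m : bimod X Y), ract m (did X) = m;
  lact_deg : forall X Y Z i j (b : dhom C Y Z) (m : bimod X Y),
    hdeg (dhom C Y Z) i b -> hdeg (bimod X Y) j m ->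
    hdeg (bimod X Z) (i + j) (lact b m);
  ract_deg : forall X Y Z i j (m : bimod Y Z) (a : dhom C X Y),
    hdeg (bimod Y Z) i m -> hdeg (dhom C X Y) j a ->
    hdeg (bimod X Z) (i + j) (ract m a);
  lact_dif : forall X Y Z i (b : dhom C Y Z) (m : bimod X Y),
    hdeg (dhom C Y Z) i b ->
    dif (lact b m) = lact (dif b) m + ksign k i *: lact b (dif m);
  ract_dif : forall X Y Z i (m : bimod Y Z) (a : dhom C X Y),
    hdeg (bimod Y Z) i m ->
    dif (ract m a) = ract (dif m) a + ksign k i *: ract m (dif a) }.

Arguments lact {k C} M {X Y Z} b m : rename.
Arguments ract {k C} M {X Y Z} m a : rename.

Definition diagonal_bimod (k : fieldType) (C : dgcat k) : dgbimod C :=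
  @DgBimod k C (dhom C) (fun X Y Z => dcomp) (fun X Y Z => dcomp)
    (fun X Y Z => @dcomp_bilin k C X Y Z) (fun X Y Z => @dcomp_bilin k C X Y Z)
    (fun X Y Z W b a m => dcompA b a m)
    (fun X Y Z W m b a => esym (dcompA m b a))
    (fun X Y Z W b m a => dcompA b m a)
    (fun X Y m => dcomp1m m) (fun X Y m => dcompm1 m)
    (fun X Y Z i j b m => @dcomp_deg k C X Y Z i j b m)
    (fun X Y Z i j m a => @dcomp_deg k C X Y Z i j m a)
    (fun X Y Z i b m => @dcomp_dif k C X Y Z i b m)
    (fun X Y Z i m a => @dcomp_dif k C X Y Z i m a).

Record bimod_map (k : fieldType) (C : dgcat k) (M N : dgbimod C) := BimodMap {
  bmap :> forall X Y, M X Y -> N X Y;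
  bmap_chain : forall X Y, chain_map (@bmap X Y);
  bmap_lact : forall X Y Z (b : dhom C Y Z) (m : M X Y),
    bmap (lact M b m) = lact N b (bmap m);
  bmap_ract : forall X Y Z (m : M Y Z) (a : dhom C X Y),
    bmap (ract M m a) = ract N (bmap m) a }.

Definition bimod_qis (k : fieldType) (C : dgcat k) (M N : dgbimod C)
    (q : bimod_map M N) : Prop :=
  forall X Y, quasi_iso (@bmap _ _ _ _ q X Y).

Definition bimod_ses (k : fieldType) (C : dgcat k) (L M N : dgbimod C)
    (i : bimod_map L M) (p : bimod_map M N) : Prop :=
  forall X Y, [/\ injective (@bmap _ _ _ _ i X Y),
                  forall n : N X Y, exists m : M X Y, p X Y m = n
                & forall m : M X Y, p X Y m = 0 <-> exists l, i X Y l = m].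

(* [P] is isomorphic to the representable bimodule
   (Z, W) |-> Hom(Y, W) (x) Hom(Z, X): it is freely generated by a closed
   element of degree 0 of P(X, Y). *)
Definition representable (k : fieldType) (C : dgcat k) (P : dgbimod C)
    (X Y : C) : Prop :=
  exists e : P X Y, cocycle 0 e /\
    forall Z W : C, is_tensor (fun (b : dhom C Y W) (a : dhom C Z X) =>
                                 lact P b (ract P e a)).

(* The classes of bimodules underlying the (strictly full) thick triangulated
   subcategories of the derived category of bimodules.  Up to isomorphism, the
   distinguished triangles there are those given by short exact sequences; in
   particular (M, cone(id_M), M[1]) covers the shifts. *)
Record thick (k : fieldType) (C : dgcat k) (S : dgbimod C -> Prop) : Prop :=
  Thick {
    thick_qis : forall M N (q : bimod_map M N), bimod_qis q -> (S M <-> S N);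
    thick_ses : forall L M N (i : bimod_map L M) (p : bimod_map M N),
      bimod_ses i p ->
      [/\ S L -> S M -> S N, S L -> S N -> S M & S M -> S N -> S L];
    thick_retract : forall M N (i : bimod_map M N) (r : bimod_map N M),
      (forall X Y (m : M X Y), r X Y (i X Y m) = m) -> S N -> S M }.

Definition perfect (k : fieldType) (C : dgcat k) (M : dgbimod C) : Prop :=
  forall S : dgbimod C -> Prop, thick S ->
    (forall P X Y, representable P X Y -> S P) -> S M.

Definition smooth_dg (k : fieldType) (C : dgcat k) : Prop :=
  perfect (diagonal_bimod C).

(* An equivalence H^0(C) ~ D of triangulated categories: [enh0] on cocycles of
   degree 0 is the functor, and [enh1] on cocycles of degree 1 encodes its
   compatibility with the shift, in the form of a natural isomorphism
   H^1(Hom(X, Y)) ~ Hom(Phi X, (Phi Y)[1]).  The values of [enh0] and [enh1] on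
   other elements are irrelevant. *)
Record enhancement (k : fieldType) (D : triangulated k) (C : dgcat k) :=
  Enhancement {
  enh_ob :> C -> D;
  enh0 : forall X Y, {linear dhom C X Y -> hom D (enh_ob X) (enh_ob Y)};
  enh1 : forall X Y, {linear dhom C X Y -> hom D (enh_ob X) (shift1 (enh_ob Y))};
  enh0_id : forall X, enh0 X X (did X) = idm (enh_ob X);
  enh0_comp : forall X Y Z (g : dhom C Y Z) (f : dhom C X Y),
    cocycle 0 g -> cocycle 0 f ->
    enh0 X Z (g \dc f) = enh0 Y Z g \c enh0 X Y f;
  enh1_compl : forall X Y Z (g : dhom C Y Z) (f : dhom C X Y),
    cocycle 0 g -> cocycle 1 f ->
    enh1 X Z (g \dc f) = fhom shift1 (enh0 Y Z g) \c enh1 X Y f;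
  enh1_compr : forall X Y Z (g : dhom C Y Z) (f : dhom C X Y),
    cocycle 1 g -> cocycle 0 f ->
    enh1 X Z (g \dc f) = enh1 Y Z g \c enh0 X Y f;
  enh0_full : forall X Y (u : hom D (enh_ob X) (enh_ob Y)),
    exists2 f : dhom C X Y, cocycle 0 f & enh0 X Y f = u;
  enh0_faithful : forall X Y (f : dhom C X Y), cocycle 0 f ->
    (enh0 X Y f = 0 <-> coboundary 0 f);
  enh1_full : forall X Y (u : hom D (enh_ob X) (shift1 (enh_ob Y))),
    exists2 f : dhom C X Y, cocycle 1 f & enh1 X Y f = u;
  enh1_faithful : forall X Y (f : dhom C X Y), cocycle 1 f ->
    (enh1 X Y f = 0 <-> coboundary 1 f);
  enh_esurj : forall E : D, exists X : C, isomorphic (enh_ob X) E;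
  enh_exact : forall X Y Z (f : dhom C X Y) (g : dhom C Y Z) (h : dhom C Z X),
    cone_triangle f g h -> distinguished (enh0 X Y f) (enh0 Y Z g) (enh1 Z X h) }.

Definition saturated (k : fieldType) (D : triangulated k) : Prop :=
  exists C : dgcat k,
    [/\ pretriangulated C, proper_dg C, smooth_dg C & inhabited (enhancement D C)].

Definition full_additive (k : fieldType) (D : triangulated k)
    (A : D -> Prop) : Prop :=
  [/\ forall X Y : D, isomorphic X Y -> A X -> A Y,
      forall Z : D, is_zero Z -> A Z
    & forall X Y B : D, is_biproduct X Y B -> A X -> A Y -> A B].

(* [filtration A E [:: k_1; ...; k_m]]: there is a sequence
   0 = E_0 -> E_1 -> ... -> E_m = E with exact triangles
   E_(i-1) -> E_i -> A_i[k_i] -> E_(i-1)[1], where k_1 > ... > k_m and the A_i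
   are nonzero objects of A. *)
Inductive filtration (k : fieldType) (D : triangulated k) (A : D -> Prop) :
    D -> seq int -> Prop :=
| filtration_nil (E : D) : is_zero E -> filtration A E [::]
| filtration_rcons (E' E A' : D) (ks : seq int) (p : int)
    (f : hom D E' E) (g : hom D E (tshift p A'))
    (h : hom D (tshift p A') (shift1 E')) :
    filtration A E' ks -> all (fun q => p < q) ks ->
    A A' -> ~ is_zero A' -> distinguished f g h ->
    filtration A E (rcons ks p).

Definition is_heart (k : fieldType) (D : triangulated k) (A : D -> Prop) : Prop :=
  [/\ full_additive A,
      forall (A1 A2 : D) (k1 k2 : int), A A1 -> A A2 -> k2 < k1 ->
        forall f : hom D (tshift k1 A1) (tshift k2 A2), f = 0
    & forall E : D, ~ is_zero E -> exists ks, filtration A E ks].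

(* For a heart and a nonzero object these are the k_1 and k_m of the (unique)
   filtration; junk value 0 if there is none. *)
Definition phi_plus (k : fieldType) (D : triangulated k) (A : D -> Prop)
    (E : D) : int :=
  xget 0 [set p | exists ks, filtration A E (p :: ks)]%classic.

Definition phi_minus (k : fieldType) (D : triangulated k) (A : D -> Prop)
    (E : D) : int :=
  xget 0 [set p | exists ks, filtration A E (rcons ks p)]%classic.

(* There is a sequence 0 = B_0 -> ... -> B_m = B whose successive cones are
   shifts of G. *)
Inductive built_from (k : fieldType) (D : triangulated k) (G : D) : D -> Prop :=
| built_zero (B : D) : is_zero B -> built_from G B
| built_step (B' B : D) (p : int)
    (f : hom D B' B) (g : hom D B (tshift p G))
    (h : hom D (tshift p G) (shift1 B')) :
    built_from G B' -> distinguished f g h -> built_from G B.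

Definition split_generator (k : fieldType) (D : triangulated k) (G : D) : Prop :=
  forall E : D, exists E' B : D, is_biproduct E E' B /\ built_from G B.

(* Main.v *)
(* For a heart A, phi+(E) <= q iff Hom(B[p], E) = 0 for all B in A and p > q, and
   phi-(E) >= q iff Hom(E, B[p]) = 0 for all B in A and p < q.  Smoothness gives a
   number d such that every composite of d ghosts (morphisms killed by all
   G[p] -> X) vanishes: the bimodules M such that, for some n, composites of n
   ghosts act by zero on H(M(X, -)) form a thick class, which contains the
   representable bimodules (Kuenneth) and hence the diagonal.  Given E, d
   successive universal ghosts E -> E_1 -> ... -> E_d, each obtained by coning off
   maps G[p] -> E_i, compose to zero, and p stays within a bounded distance of
   { p | Hom(G[p], E) <> 0 }.  Applying F^m and Hom(B[q], -), each step is
   injective as soon as q > phi+(F^m G) + p, while the composite is zero; hence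
     phi+(F^m E) <= phi+(F^m G) + max { p | Hom(G[p], E) <> 0 } + const,
   where the maximum is at most phi+(E) - phi-(G).  For E = F^n G this is
   subadditivity up to a constant, and Fekete's lemma applies; E = G', respectively
   m = 0 with two hearts, gives independence of the choices.  The lower bound
   needed in Fekete's lemma comes from E = F G, for which { p | Hom(G[p], E) <> 0 }
   is finite.  The argument for phi- is dual, except that the lower bound for
   { p | Hom(G[p], E) <> 0 } in terms of phi-(E) needs Serre duality. *)
From HB Require Import structures.
Require Import Defs.
From mathcomp Require Import all_boot all_order all_algebra.
From mathcomp Require Import all_classical all_reals all_analysis.

From mathcomp Require Import zify.

Set Implicit Arguments.
Unset Strict Implicit.
Unset Printing Implicit Defensive.

Import Defs.
Import Order.TTheory GRing.Theory Num.Theory.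
Import numFieldNormedType.Exports.
Local Open Scope classical_set_scope.
Local Open Scope ring_scope.

(** * Linear algebra over a field: complements, pseudo-inverses, null-homotopies *)

Section LinearAlgebra.
Variable k : fieldType.

Definition linear_fun (U V : lmodType k) (f : U -> V) of linear f := f.

HB.instance Definition _ (U V : lmodType k) (f : U -> V) (fL : linear f) :=
  GRing.isLinear.Build k U V *:%R (linear_fun fL) fL.

(** Two values over the same point differ by a value over 0, so [R] is the graph of a function, and
    that function is linear. Linear maps are built below by specifying their values this way. *)
Lemma linear_of_relation (U V : lmodType k) (R : U -> V -> Prop) :
  (forall a x x' y y', R x y -> R x' y' -> R (a *: x + x') (a *: y + y')) ->
  (forall x, exists y, R x y) -> (forall y, R 0 y -> y = 0) ->
  exists f : {linear U -> V}, forall x, R x (f x).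
Proof.
move=> Rlin Rtot R0.
have [f Rf] := choice Rtot.
have Runiq x y y' : R x y -> R x y' -> y = y'.
  move=> Rxy Rxy'; apply/eqP; rewrite -subr_eq0; apply/eqP/R0.
  by have := Rlin (-1) _ _ _ _ Rxy' Rxy; rewrite !scaleN1r addNr addrC.
have fL : linear f by move=> a x y; exact: Runiq (Rf _) (Rlin _ _ _ _ _ _ _).
by exists (linear_fun fL).
Qed.

(** By Zorn's lemma there is a maximal subspace meeting [P] only in 0. If some v were outside
    [P + Q], adjoining v to [Q] would contradict maximality. *)
Lemma subspace_complement (V : lmodType k) (P : V -> Prop) :
  P 0 -> (forall a x y, P x -> P y -> P (a *: x + y)) ->
  exists Q : V -> Prop,
    [/\ forall a x y, Q x -> Q y -> Q (a *: x + y),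
        forall x, P x -> Q x -> x = 0
      & forall v, exists p q, [/\ P p, Q q & v = p + q]].
Proof.
move=> P0 Plin.
have PN x : P x -> P (- x).
  by move=> Px; rewrite -[- x]addr0 -scaleN1r; exact: Plin.
have PD x y : P x -> P y -> P (x + y).
  by move=> Px Py; rewrite -[x]scale1r; exact: Plin.
pose good (Q : set V) := (forall a x y, Q x -> Q y -> Q (a *: x + y)) /\
  (forall x, P x -> Q x -> x = 0).
have [F Fgood Ftot|Q [[Qlin PQ] Qmax]] := @Zorn_bigcup V good.
  split=> [a x y [X FX Xx] [Y FY Yy]|x Px [X FX Xx]]; last first.
    by have [_] := Fgood _ FX; exact.
  have [XY|YX] := Ftot _ _ FX FY.
    by exists Y => //; have [Yl _] := Fgood _ FY; apply: Yl => //; exact: XY.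
  by exists X => //; have [Xl _] := Fgood _ FX; apply: Xl => //; exact: YX.
exists Q; split=> // v; apply: contrapT => nv.
(* The empty set satisfies [good] vacuously, so [Q 0] has to come from maximality: otherwise [Q] is
   empty and {0} is larger. *)
have Q0 : Q 0.
  apply: contrapT => nQ0; apply: (Qmax [set 0]).
    split=> [x Qx|/(_ 0)]; last by move=> /(_ erefl).
    by case: nQ0; have := Qlin (-1) _ _ Qx Qx; rewrite scaleN1r addNr.
  by split=> [a x y -> ->|]; rewrite ?scaler0 ?addr0.
apply: (Qmax [set x | exists a q, Q q /\ x = a *: v + q]).
  split=> [q Qq|sub]; first by exists 0, q; rewrite scale0r add0r.
  apply: nv; exists 0, v; rewrite add0r; split=> //.
  by apply: sub; exists 1, 0; rewrite scale1r addr0.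
split=> [a _ _ [b [q [Qq ->]]] [c [r [Qr ->]]]|x Px [a [q [Qq xE]]]].
  exists (a * b + c), (a *: q + r); split; first exact: Qlin.
  by rewrite scalerDr scalerA scalerDl addrACA.
have [a0|a0] := eqVneq a 0.
  by apply: PQ => //; rewrite xE a0 scale0r add0r.
case: nv; exists (a^-1 *: x), (- a^-1 *: q); split.
- by rewrite -[_ *: _]addr0; exact: Plin.
- by rewrite -[_ *: _]addr0; exact: Qlin.
- by rewrite xE scalerDr scalerA mulVf// scale1r scaleNr addrK.
Qed.

(** Choose a complement C of the kernel and a complement Q of the image. Then [s] sends y to the
    unique c in C with y - d c in Q. *)
Lemma linear_pseudo_inverse (U V : lmodType k) (d : {linear U -> V}) :
  exists s : {linear V -> U}, forall x, d (s (d x)) = d x.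
Proof.
have [||C [Clin C0 Ctot]] := @subspace_complement U (fun x => d x = 0).
- by rewrite raddf0.
- by move=> a x y dx dy; rewrite linearP dx dy scaler0 addr0.
have [||Q [Qlin Q0 Qtot]] := @subspace_complement V (fun y => exists x, y = d x).
- by exists 0; rewrite raddf0.
- by move=> a _ _ [x ->] [y ->]; exists (a *: x + y); rewrite linearP.
have [a x x' y y' [Cy Qy] [Cy' Qy']|y|y [Cy Qy]|s sP] :=
    @linear_of_relation V U (fun y x => C x /\ Q (y - d x)).
- split; first exact: Clin.
  by rewrite linearP opprD addrACA -scalerN -scalerDr; exact: Qlin.
- have [_ [q [[x ->] Qq ->]]] := Qtot y.
  have [x0 [c [dx0 Cc ->]]] := Ctot x.
  by exists c; split=> //; rewrite raddfD /= dx0 add0r addrAC subrr add0r.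
- apply: C0 => //; apply/eqP; rewrite -oppr_eq0; apply/eqP/Q0.
    by exists (- y); rewrite raddfN.
  by move: Qy; rewrite sub0r.
exists s => x; have [Cs Qs] := sP (d x).
apply/esym/eqP; rewrite -subr_eq0; apply/eqP/Q0 => //.
by exists (x - s (d x)); rewrite raddfB.
Qed.

(* With [d s d = d] and [d' s' d' = d'], the homotopy
   [g s d s (1 - s d) + s' g (1 - d s) (1 - s d)] works. *)
Lemma null_on_cohomology_homotopy (U V : lmodType k) (d : {linear U -> U})
    (d' : {linear V -> V}) (g : {linear U -> V}) :
  (forall x, d (d x) = 0) -> (forall x, g (d x) = d' (g x)) ->
  (forall x, d x = 0 -> exists y, g x = d' y) ->
  exists h : {linear U -> V}, forall x, d' (h x) + h (d x) = g x.
Proof.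
move=> dd gd g0.
have [s sP] := linear_pseudo_inverse d.
have [s' sP'] := linear_pseudo_inverse d'.
have pL (r t : {linear U -> U}) : linear (fun x => x - r (t x)).
  by move=> a x y; rewrite !linearP addrACA -scalerDr.
pose p : {linear U -> U} := linear_fun (pL s d).
pose q : {linear U -> U} := linear_fun (pL d s).
have hL : linear (fun x => g (s (d (s (p x)))) + s' (g (q (p x)))).
  by move=> a x y; rewrite !linearP addrACA -scalerDr.
have pE x : p x = x - s (d x) by [].
have qE x : q x = x - d (s x) by [].
have pd x : p (d x) = d x by rewrite pE dd linear0 subr0.
have dp x : d (p x) = 0 by rewrite pE linearB /= sP subrr.
have qd x : q (d x) = 0 by rewrite qE sP subrr.
have [h hE] : exists h : {linear U -> V},
    forall x, h x = g (s (d (s (p x)))) + s' (g (q (p x))).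
  by exists (linear_fun hL).
exists h => x; rewrite !hE pd qd !linear0 addr0 sP.
have [|y gy] := g0 (q (p x)); first by rewrite qE linearB /= dd dp subrr.
rewrite linearD /= gy sP' -gy -gd sP -!linearD /= qE pE.
by congr (g _); rewrite addrCA subrr addr0 subrK.
Qed.

End LinearAlgebra.

(** * Homogeneous components of complexes *)

Section Complexes.
Variable k : fieldType.
Implicit Types V W : complex k.

Lemma hdeg_add V n x y : hdeg V n x -> hdeg V n y -> hdeg V n (x + y).
Proof. by move=> Vx Vy; rewrite -[x]scale1r; exact: hdegP. Qed.

Lemma hdeg_opp V n x : hdeg V n x -> hdeg V n (- x).
Proof.
by move=> Vx; rewrite -[- x]addr0 -scaleN1r; apply: hdegP => //; exact: hdeg0.
Qed.

Lemma hdeg_ind V (P : V -> Prop) :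
  (forall n x, hdeg V n x -> P x) -> (forall x y, P x -> P y -> P (x + y)) ->
  forall x, P x.
Proof.
move=> Ph PD x; have [s [y [Vy ->]]] := hdeg_span x.
by apply: (big_ind P) => [|//|n _]; apply: Ph; [exact: (@hdeg0 k V 0)|].
Qed.

Let decomp V (x : V) (y : int -> V) := (forall n, hdeg V n (y n)) /\
  exists s, [/\ uniq s, forall n, n \notin s -> y n = 0 & x = \sum_(n <- s) y n].

Let sum_widen V (y : int -> V) (s t : seq int) : uniq s -> uniq t ->
  {subset s <= t} -> (forall n, n \notin s -> y n = 0) ->
  \sum_(n <- s) y n = \sum_(n <- t) y n.
Proof.
move=> us ut st y0; rewrite [RHS](bigID (mem s)) /= [X in _ + X]big1 ?addr0//.
rewrite -[RHS]big_filter; apply: perm_big; apply: uniq_perm => //.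
  exact: filter_uniq.
by move=> n; rewrite mem_filter; case: (boolP (n \in s)) => //= /st ->.
Qed.

Let decompP V a (x x' : V) y y' : decomp x y -> decomp x' y' ->
  decomp (a *: x + x') (fun n => a *: y n + y' n).
Proof.
move=> [Vy [s [us y0 ->]]] [Vy' [s' [us' y0' ->]]].
split=> [n|]; first exact: hdegP.
exists (undup (s ++ s')); split=> [|n|]; first exact: undup_uniq.
  rewrite mem_undup mem_cat negb_or => /andP[ns ns'].
  by rewrite y0// y0'// scaler0 addr0.
rewrite big_split /= -scaler_sumr; congr (_ *: _ + _).
  by apply: sum_widen; rewrite ?undup_uniq// => n sn; rewrite mem_undup mem_cat sn.
apply: sum_widen; rewrite ?undup_uniq// => n sn.
by rewrite mem_undup mem_cat sn orbT.
Qed.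

Let decomp0 V (y : int -> V) : decomp 0 y -> forall n, y n = 0.
Proof.
move=> [Vy [s [us y0 /esym ys]]] n.
case: (boolP (n \in s)) => [|/y0//].
exact: (hdeg_free us Vy ys).
Qed.

Let decomp_hom V n (x : V) : hdeg V n x ->
  decomp x (fun m => if m == n then x else 0).
Proof.
move=> Vx; split=> [m|]; first by case: eqP => [->//|_]; exact: hdeg0.
exists [:: n]; split=> // [m|]; first by rewrite inE => /negPf ->.
by rewrite big_seq1 eqxx.
Qed.

Let decomp_ex V (x : V) : exists y, decomp x y.
Proof.
elim/hdeg_ind: x => [n x Vx|x x' [y xy] [y' xy']].
  by exists (fun m => if m == n then x else 0); exact: decomp_hom.
by have := decompP 1 xy xy'; rewrite scale1r; eexists; eassumption.
Qed.

(** The projections hidden in the internal direct sum: decompositions add up linearly, and by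
    [hdeg_free] the only decomposition of 0 is the trivial one. *)
Lemma homogeneous_component V : exists c : int -> {linear V -> V},
  [/\ forall n x, hdeg V n (c n x),
      forall x, exists s, x = \sum_(n <- s) c n x,
      forall n x, hdeg V n x -> c n x = x
    & forall m n x, hdeg V n x -> m != n -> c m x = 0].
Proof.
have /choice[c cP] n : exists c : {linear V -> V},
    forall x y, decomp x y -> c x = y n.
  have [||y [z [z0 ->]]|c cP] :=
    @linear_of_relation k V V (fun x v => exists y, decomp x y /\ v = y n).
  - move=> a x x' _ _ [y [xy ->]] [y' [xy' ->]].
    by eexists; split; first exact: decompP xy xy'.
  - by move=> x; have [y xy] := decomp_ex x; exists (y n), y.
  - exact: decomp0.
  exists c => x y xy; have [z [xz ->]] := cP x.
  have := decompP (-1) xy xz; rewrite scaleN1r addNr => /decomp0/(_ n).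
  by rewrite scaleN1r addrC => /eqP; rewrite subr_eq0 => /eqP.
exists c; split=> [n x|x|n x Vx|m n x Vx mn].
- by have [y xy] := decomp_ex x; rewrite (cP _ _ _ xy); case: xy.
- have [y xy] := decomp_ex x; have [_ [s [_ _ xE]]] := xy.
  by exists s; rewrite {1}xE; apply: eq_bigr => n _; rewrite (cP _ _ _ xy).
- by rewrite (cP _ _ _ (decomp_hom Vx)) eqxx.
- by rewrite (cP _ _ _ (decomp_hom Vx)) (negPf mn).
Qed.

Lemma component_dif V (c : int -> {linear V -> V}) :
  (forall n x, hdeg V n x -> c n x = x) ->
  (forall m n x, hdeg V n x -> m != n -> c m x = 0) ->
  forall n x, c (n + 1) (dif x) = dif (c n x).
Proof.
move=> cE c0 n x; elim/hdeg_ind: x => [m x Vx|x y cx cy]; last first.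
  by rewrite !linearD cx cy.
have [<-|mn] := eqVneq m n; first by rewrite !(cE m)// cE//; exact: dif_deg.
rewrite (c0 n m)// 1?eq_sym// linear0 (c0 _ (m + 1))//; first exact: dif_deg.
by rewrite (inj_eq (addIr 1)) eq_sym.
Qed.

(** A primitive of mixed degree may be replaced by its component of degree n - 1. This lets later
    arguments produce primitives without tracking degrees. *)
Lemma coboundaryP V n (x y : V) : hdeg V n x -> x = dif y -> coboundary n x.
Proof.
have [c [ch _ cE c0]] := homogeneous_component V.
move=> Vx xy; exists (c (n - 1) y); split=> //.
by rewrite -(component_dif cE c0) subrK -xy cE.
Qed.

Lemma cocycle_ind V (P : V -> Prop) : P 0 -> (forall n x, cocycle n x -> P x) ->
  (forall x y, P x -> P y -> P (x + y)) -> forall x, dif x = 0 -> P x.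
Proof.
have [c [ch cs cE c0]] := homogeneous_component V.
move=> P0 Ph PD x dx; have [s ->] := cs x.
apply: (big_ind P) => // n _; apply: (Ph n); split=> //.
by rewrite -(component_dif cE c0) dx linear0.
Qed.

(** The projection onto the even part. It turns Koszul signs into linear operators on the total
    space. *)
Lemma parity_projection V : exists e : {linear V -> V},
  forall n x, hdeg V n x -> e x = if odd `|n|%N then 0 else x.
Proof.
have [c [ch cs cE c0]] := homogeneous_component V.
have cinj x : (forall n, c n x = 0) -> x = 0.
  by move=> cx; have [s ->] := cs x; rewrite big1.
have [a x x' y y' xy xy' n|x|y y0|e eP] := @linear_of_relation k V V
  (fun x y => forall n, c n y = if odd `|n|%N then 0 else c n x).
- by rewrite !linearP xy xy'; case: ifP; rewrite // scaler0 addr0.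
- elim/hdeg_ind: x => [m x Vx|x x' [y xy] [y' xy']].
    exists (if odd `|m|%N then 0 else x) => n.
    have [<-|nm] := eqVneq m n; first by case: ifP => _; rewrite ?linear0.
    have cx : c n x = 0 by apply: (c0 n m x) => //; rewrite eq_sym.
    by rewrite cx if_same; case: ifP; rewrite ?linear0.
  by exists (y + y') => n; rewrite !linearD xy xy'; case: ifP; rewrite // addr0.
- by apply: cinj => n; rewrite y0 linear0 if_same.
exists e => n x Vx; apply/eqP; rewrite -subr_eq0; apply/eqP/cinj => m.
rewrite linearB /= eP; have [->|mn] := eqVneq m n.
  by case: ifP => _; [rewrite !linear0 addr0 | rewrite subrr].
have cx : c m x = 0 by exact: (c0 m n x).
by rewrite cx if_same sub0r; case: ifP; rewrite ?linear0 ?cx ?oppr0.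
Qed.

End Complexes.

(** * Linear categories, isomorphisms and equivalences *)

Section LinearCategories.
Variable k : fieldType.

Section Composition.
Variable C : lincat k.
Implicit Types X Y Z W : C.

Lemma mcomp_linear_l X Y Z (f : hom C X Y) : linear (fun g : hom C Y Z => g \c f).
Proof. by have [+ _] := @comp_bilin k C X Y Z; exact. Qed.

Lemma mcomp_linear_r X Y Z (g : hom C Y Z) : linear (fun f : hom C X Y => g \c f).
Proof. by have [_] := @comp_bilin k C X Y Z; exact. Qed.

Lemma comp0m X Y Z (f : hom C X Y) : (0 : hom C Y Z) \c f = 0.
Proof. exact: linear0 (linear_fun (@mcomp_linear_l X Y Z f)). Qed.

Lemma compm0 X Y Z (g : hom C Y Z) : g \c (0 : hom C X Y) = 0.
Proof. exact: linear0 (linear_fun (@mcomp_linear_r X Y Z g)). Qed.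

Lemma compNm X Y Z (g : hom C Y Z) (f : hom C X Y) : (- g) \c f = - (g \c f).
Proof. exact: linearN (linear_fun (@mcomp_linear_l X Y Z f)) g. Qed.

Lemma compmN X Y Z (g : hom C Y Z) (f : hom C X Y) : g \c (- f) = - (g \c f).
Proof. exact: linearN (linear_fun (@mcomp_linear_r X Y Z g)) f. Qed.

Lemma compmB X Y Z (g : hom C Y Z) (f f' : hom C X Y) :
  g \c (f - f') = g \c f - g \c f'.
Proof. exact: linearB (linear_fun (@mcomp_linear_r X Y Z g)) f f'. Qed.

Lemma compm_sum X Y Z (g : hom C Y Z) n (a : 'I_n -> k) (f : 'I_n -> hom C X Y) :
  g \c (\sum_i a i *: f i) = \sum_i a i *: (g \c f i).
Proof.
rewrite -[LHS]/(linear_fun (@mcomp_linear_r X Y Z g) _) linear_sum.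
by apply: eq_bigr => i _; rewrite linearZ.
Qed.

Lemma is_iso_inv X Y (f : hom C X Y) (g : hom C Y X) :
  g \c f = idm X -> f \c g = idm Y -> is_iso g.
Proof. by move=> gf fg; exists f. Qed.

Lemma is_iso_id X : is_iso (idm X).
Proof. by exists (idm X); rewrite comp1m. Qed.

Lemma is_iso_comp X Y Z (g : hom C Y Z) (f : hom C X Y) :
  is_iso g -> is_iso f -> is_iso (g \c f).
Proof.
move=> [g' [g'g gg']] [f' [f'f ff']]; exists (f' \c g').
rewrite -!compA; split.
  by rewrite (compA g') g'g comp1m.
by rewrite (compA f) ff' comp1m.
Qed.

Lemma isomorphic_refl X : isomorphic X X.
Proof. by exists (idm X); exact: is_iso_id. Qed.

Lemma isomorphic_sym X Y : isomorphic X Y -> isomorphic Y X.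
Proof. by move=> [f [g [gf fg]]]; exists g; exact: is_iso_inv gf fg. Qed.

Lemma isomorphic_trans Y X Z : isomorphic X Y -> isomorphic Y Z -> isomorphic X Z.
Proof. by move=> [f fi] [g gi]; exists (g \c f); exact: is_iso_comp. Qed.

Lemma is_zeroP X : idm X = 0 -> is_zero X.
Proof.
move=> X0 Y; split=> f; first by rewrite -(comp1m f) X0 comp0m.
by rewrite -(compm1 f) X0 compm0.
Qed.

Lemma is_zero_id X : is_zero X -> idm X = 0.
Proof. by move=> /(_ X)[+ _]; exact. Qed.

Lemma hom_to_zero X Y (f : hom C X Y) : is_zero Y -> f = 0.
Proof. by move=> /(_ X)[+ _]; exact. Qed.

Lemma hom_from_zero X Y (f : hom C X Y) : is_zero X -> f = 0.
Proof. by move=> /(_ Y)[_]; exact. Qed.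

End Composition.

Lemma functor_is_iso (C D : lincat k) (F : linfunctor C D) (X Y : C)
  (f : hom C X Y) : is_iso f -> is_iso (fhom F f).
Proof.
by move=> [g [gf fg]]; exists (fhom F g); rewrite -!fhom_comp gf fg !fhom1.
Qed.

Lemma functor_isomorphic (C D : lincat k) (F : linfunctor C D) (X Y : C) :
  isomorphic X Y -> isomorphic (F X) (F Y).
Proof. by move=> [f fi]; exists (fhom F f); exact: functor_is_iso. Qed.

Lemma functor_is_zero (C D : lincat k) (F : linfunctor C D) (X : C) :
  is_zero X -> is_zero (F X).
Proof.
by move=> /is_zero_id X0; apply: is_zeroP; rewrite -fhom1 X0 linear0.
Qed.

Lemma faithful_of_retraction (C D : lincat k) (F : linfunctor C D)
    (G : linfunctor D C) : nat_iso (comp_functor G F) (id_functor C) ->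
  forall X Y : C, injective (@fhom k C D F X Y).
Proof.
move=> [t [ti tn]] X Y f f' ff.
have [t' [_ tt']] := ti X.
rewrite -(compm1 f) -(compm1 f') -tt' !compA.
have /= <- := tn X Y f; have /= <- := tn X Y f'.
by rewrite ff.
Qed.

Lemma full_of_quasi_inverse (C D : lincat k) (F : linfunctor C D)
    (G : linfunctor D C) : quasi_inverse F G ->
  forall (X Y : C) (u : hom D (F X) (F Y)), exists f, fhom F f = u.
Proof.
move=> [GF FG] X Y u; have [t [ti tn]] := GF.
have [t' [t't _]] := ti X.
have [s' [s's _]] := ti Y.
exists (t Y \c fhom G u \c t').
apply: (faithful_of_retraction FG).
set f := _ \c t'.
have /= tf := tn X Y f.
rewrite -[LHS]comp1m -s's -compA tf /f -!compA t't compm1.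
by rewrite compA s's comp1m.
Qed.

End LinearCategories.

(** * Properties of vector spaces that pass to quotients *)

Section FinDim.
Variable k : fieldType.

(** Abstracts what vanishing and finite-dimensionality share, so that both are transported along
    isomorphisms and shifts of Hom spaces by one argument. *)
Definition surjection_closed (Q : lmodType k -> Prop) :=
  forall (U V : lmodType k) (f : {linear U -> V}), (forall v, exists u, f u = v) ->
  Q U -> Q V.

Definition all_zero (V : lmodType k) := forall v : V, v = 0.

Lemma all_zero_surjection_closed : surjection_closed all_zero.
Proof. by move=> U V f fs U0 v; have [u <-] := fs v; rewrite (U0 u) linear0. Qed.

Lemma fin_dim_surjection_closed : surjection_closed (@fin_dim k).
Proof.
move=> U V f fs [n [e eU]]; exists n, (fun i => f (e i)) => v.
have [u <-] := fs v; have [c ->] := eU u; exists c.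
by rewrite linear_sum; apply: eq_bigr => i _; rewrite linearZ.
Qed.

End FinDim.

(** * Shifts and exactness of Hom in a triangulated category *)

Section Triangulated.
Variables (k : fieldType) (D : triangulated k).
Implicit Types (X Y Z W : D) (n m p : int).

Lemma quasi_inverse_sym (C C' : lincat k) (F : linfunctor C C')
  (G : linfunctor C' C) : quasi_inverse F G -> quasi_inverse G F.
Proof. by case. Qed.

Lemma shift_faithful X Y : injective (@fhom k D D shift1 X Y).
Proof. by have [us _] := @shift1K k D; exact: faithful_of_retraction us X Y. Qed.

Lemma shift_full X Y (u : hom D (shift1 X) (shift1 Y)) :
  exists f, fhom shift1 f = u.
Proof. exact: full_of_quasi_inverse (shift1K D) X Y u. Qed.

Lemma shift_unshift X : isomorphic (shift1 (unshift1 X)) X.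
Proof. by have [_ [t [ti _]]] := shift1K D; exists (t X); exact: ti. Qed.

Lemma unshift_shift X : isomorphic (unshift1 (shift1 X)) X.
Proof. by have [[t [ti _]] _] := shift1K D; exists (t X); exact: ti. Qed.

(** Negative shifts iterate a quasi-inverse of [shift1], so shifts add up only up to isomorphism. *)
Lemma shift_tshift n X : isomorphic (shift1 (tshift n X)) (tshift (n + 1) X).
Proof.
case: n => [m|[|m]].
- by rewrite addrC -intS; exact: isomorphic_refl.
- exact: shift_unshift.
- have -> : Negz m.+1 + 1 = Negz m by lia.
  exact: shift_unshift.
Qed.

Lemma unshift_tshift n X : isomorphic (unshift1 (tshift n X)) (tshift (n - 1) X).
Proof.
case: n => [[|m]|m].
- by rewrite add0r; exact: isomorphic_refl.
- have -> : Posz m.+1 - 1 = Posz m by lia.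
  exact: unshift_shift.
- have -> : Negz m - 1 = Negz m.+1 by lia.
  exact: isomorphic_refl.
Qed.

Section HomTransfer.
Variables (Q : lmodType k -> Prop) (Qs : surjection_closed Q).

Lemma hom_iso X X' Y Y' : isomorphic X X' -> isomorphic Y Y' ->
  Q (hom D X Y) -> Q (hom D X' Y').
Proof.
move=> [a [a' [_ aa']]] [b [b' [_ bb']]].
apply: (Qs (f := linear_fun (@mcomp_linear_r k D X' Y Y' b) \o
                 linear_fun (@mcomp_linear_l k D X' X Y a'))) => v.
exists (b' \c v \c a); rewrite /= /linear_fun -!compA aa' compm1.
by rewrite compA bb' comp1m.
Qed.

Let hom_functor (F G : linfunctor D D) : quasi_inverse F G ->
  forall X Y, Q (hom D X Y) -> Q (hom D (F X) (F Y)).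
Proof.
move=> FG X Y; apply: (Qs (f := @fhom k D D F X Y)).
exact: full_of_quasi_inverse FG X Y.
Qed.

Lemma hom_tshift p n m X Y : Q (hom D (tshift n X) (tshift m Y)) ->
  Q (hom D (tshift (n + p) X) (tshift (m + p) Y)).
Proof.
move=> QXY; elim/int_ind: p => [|p IHp|p IHp]; first by rewrite !addr0.
  rewrite intS [1 + _]addrC !addrA.
  apply: (hom_iso (shift_tshift _ _) (shift_tshift _ _)).
  exact: (hom_functor (shift1K D)).
have -> : - p.+1%:Z = - p%:Z - 1 by lia.
rewrite !addrA; apply: (hom_iso (unshift_tshift _ _) (unshift_tshift _ _)).
exact: (hom_functor (quasi_inverse_sym (shift1K D))).
Qed.

End HomTransfer.

Lemma exact_comp0 X Y Z (f : hom D X Y) (g : hom D Y Z) (h : hom D Z (shift1 X)) :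
  distinguished f g h -> g \c f = 0.
Proof.
move=> fgh; have [[T T0] _] := tadditive D.
have [|c [cg _]] := exact_mor (a := idm X) (b := f) (exact_id X T0) fgh.
  by [].
by rewrite -cg compm0.
Qed.

(** Exactness of Hom(-, W), from a morphism to the triangle 0 -> W -> W. *)
Lemma exact_extend X Y Z W (f : hom D X Y) (g : hom D Y Z)
    (h : hom D Z (shift1 X)) (y : hom D Y W) :
  distinguished f g h -> y \c f = 0 -> exists c : hom D Z W, y = c \c g.
Proof.
move=> fgh yf; have [[T T0] _] := tadditive D.
have sT : is_zero (shift1 T : D) by exact: functor_is_zero.
have T1 : distinguished (0 : hom D T W) (idm W) (0 : hom D W (shift1 T)).
  by apply/exact_rot; rewrite linear0 oppr0; exact: exact_id.
have [|c [cg _]] := exact_mor (a := 0) (b := y) fgh T1.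
  by rewrite yf compm0.
by exists c; rewrite cg comp1m.
Qed.

(** Exactness of Hom(W, -): a morphism from the triangle W -> 0 -> W[1] to the rotated one gives a
    map W[1] -> X[1], which comes from W -> X because the shift is full; faithfulness then gives the
    equation. *)
Lemma exact_lift X Y Z W (f : hom D X Y) (g : hom D Y Z)
    (h : hom D Z (shift1 X)) (w : hom D W Y) :
  distinguished f g h -> g \c w = 0 -> exists v : hom D W X, w = f \c v.
Proof.
move=> /exact_rot fgh gw; have [[T T0] _] := tadditive D.
have /exact_rot W1 := exact_id W T0.
have [|c [_]] := exact_mor (a := w) (b := 0) W1 fgh.
  by rewrite gw !compm0.
have [v <-] := shift_full c.
rewrite fhom1 compmN compm1 compNm -fhom_comp => /oppr_inj/shift_faithful ->.
by exists v.
Qed.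

End Triangulated.

(** * Composites and powers of exact functors; compatibility with shifts *)

Section ExactFunctors.
Variable k : fieldType.

Definition id_exact (D : triangulated k) : exact_functor D D.
Proof.
apply: (@ExactFunctor k D D (id_functor D) (fun X => idm (shift1 X))).
- by move=> X; exact: is_iso_id.
- by move=> X Y f; rewrite comp1m compm1.
- by move=> X Y Z f g h fgh /=; rewrite comp1m.
Defined.

Definition comp_exact (D : triangulated k) (F G : exact_functor D D) :
  exact_functor D D.
Proof.
apply: (@ExactFunctor k D D (comp_functor F G)
  (fun X => eshift F (G X) \c fhom F (eshift G X))).
- move=> X; apply: is_iso_comp; first exact: eshift_iso.
  by apply: functor_is_iso; exact: eshift_iso.
- move=> X Y f /=; rewrite -compA -fhom_comp eshift_nat fhom_comp !compA.
  by rewrite eshift_nat.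
- move=> X Y Z f g h fgh /=; rewrite -compA -fhom_comp.
  by do 2 apply: efun_exact.
Defined.

(** [fpow] iterates on objects only; the general bound on exact functors is applied to this version
    of the powers. *)
Fixpoint exact_iter (D : triangulated k) (F : exact_functor D D) n :=
  if n is m.+1 then comp_exact F (exact_iter F m) else id_exact D.

Lemma exact_iterE (D : triangulated k) (F : exact_functor D D) n (E : D) :
  exact_iter F n E = fpow F n E.
Proof. by elim: n => //= n ->. Qed.

Lemma exact_functor_tshift (D : triangulated k) (F : exact_functor D D) n (X : D) :
  isomorphic (F (tshift n X)) (tshift n (F X)).
Proof.
elim/int_ind: n => [|n IHn|n IHn]; first exact: isomorphic_refl.
  apply: isomorphic_trans (functor_isomorphic shift1 IHn).
  by eexists; exact: eshift_iso.
have nE : - n.+1%:Z = - n%:Z - 1 by lia.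
rewrite nE; apply: isomorphic_trans (unshift_tshift _ _).
apply: isomorphic_trans (functor_isomorphic unshift1 IHn).
apply: isomorphic_trans (functor_isomorphic F (isomorphic_sym (unshift_tshift _ _))) _.
(* With U the quasi-inverse of the shift: F(U Y) ~ U((F(U Y))[1]) ~ U(F((U Y)[1])) ~ U(F Y). *)
set Y := tshift _ X; apply: isomorphic_trans (isomorphic_sym (unshift_shift _)) _.
apply: functor_isomorphic.
apply: (@isomorphic_trans _ _ (F (shift1 (unshift1 Y)))).
  by apply: isomorphic_sym; eexists; exact: eshift_iso.
by apply: functor_isomorphic; exact: shift_unshift.
Qed.

End ExactFunctors.

(** * Hearts: phi+ and phi- in terms of vanishing of Hom *)

Section Hearts.
Variables (k : fieldType) (D : triangulated k).

Implicit Types (X Y Z W E : D) (t p q : int).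

Definition hom0 (X Y : D) := all_zero (hom D X Y).

Let az := @all_zero_surjection_closed k.

Lemma hom0_iso X X' Y Y' : isomorphic X X' -> isomorphic Y Y' ->
  hom0 X Y -> hom0 X' Y'.
Proof. exact: hom_iso az _ _ _ _. Qed.

Lemma hom0_tshift p n m X Y : hom0 (tshift n X) (tshift m Y) <->
  hom0 (tshift (n + p) X) (tshift (m + p) Y).
Proof.
split; first exact: (hom_tshift az p).
by move=> /(hom_tshift az (- p)); rewrite !addrK.
Qed.

Lemma hom0_refl X : hom0 X X -> is_zero X.
Proof. by move=> X0; apply: is_zeroP; exact: X0. Qed.

Lemma is_zero_tshift p X : is_zero (tshift p X) -> is_zero X.
Proof.
move=> X0; apply: hom0_refl; have [_] := @hom0_tshift p 0 0 X X; rewrite add0r.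
by apply => f; exact: hom_to_zero.
Qed.

Lemma exact_hom0_l X Y Z W (f : hom D X Y) (g : hom D Y Z) (h : hom D Z (shift1 X)) :
  distinguished f g h -> hom0 X W -> hom0 Z W -> hom0 Y W.
Proof.
move=> fgh XW ZW y; have [c ->] := exact_extend fgh (XW (y \c f)).
by rewrite (ZW c) comp0m.
Qed.

Lemma exact_hom0_r X Y Z W (f : hom D X Y) (g : hom D Y Z) (h : hom D Z (shift1 X)) :
  distinguished f g h -> hom0 W X -> hom0 W Z -> hom0 W Y.
Proof.
move=> fgh WX WZ y; have [c ->] := exact_lift fgh (WZ (g \c y)).
by rewrite (WX c) compm0.
Qed.

(** The kernel of Hom(W, X) -> Hom(W, Y) is the image of Hom(W[1], Z). *)
Lemma exact_mono X Y Z W (f : hom D X Y) (g : hom D Y Z) (h : hom D Z (shift1 X))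
    (w : hom D W X) :
  distinguished f g h -> hom0 (shift1 W) Z -> f \c w = 0 -> w = 0.
Proof.
move=> /exact_rot/exact_rot fgh WZ fw; apply: (@shift_faithful k D).
have [|v ->] := exact_lift (w := fhom shift1 w) fgh.
  by rewrite compNm -fhom_comp fw !linear0.
by rewrite (WZ v) compm0 linear0.
Qed.

Variable A : D -> Prop.

(** For a heart and a nonzero E these mean phi+(E) <= t and phi-(E) >= t, as [phi_plusP] and
    [phi_minusP] show. On zero objects they hold for every t, so bounds can be carried through
    functors without asking whether an image vanishes. *)
Definition hom_above t (E : D) := forall B p, A B -> t < p -> hom0 (tshift p B) E.
Definition hom_below t (E : D) := forall B p, A B -> p < t -> hom0 E (tshift p B).

Lemma filtration_hom0_l E ks Y : filtration A E ks ->
  (forall p B, p \in ks -> A B -> hom0 (tshift p B) Y) -> hom0 E Y.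
Proof.
elim=> {E ks} [E E0 _ f|E' E A' ks p f g h _ IH _ AA' _ fgh EY].
  exact: hom_from_zero.
apply: (exact_hom0_l fgh); last by apply: EY => //; rewrite mem_rcons inE eqxx.
by apply: IH => q B qks; apply: EY; rewrite mem_rcons inE qks orbT.
Qed.

Lemma filtration_hom0_r E ks Y : filtration A E ks ->
  (forall p B, p \in ks -> A B -> hom0 Y (tshift p B)) -> hom0 Y E.
Proof.
elim=> {E ks} [E E0 _ f|E' E A' ks p f g h _ IH _ AA' _ fgh EY].
  exact: hom_to_zero.
apply: (exact_hom0_r fgh); last by apply: EY => //; rewrite mem_rcons inE eqxx.
by apply: IH => q B qks; apply: EY; rewrite mem_rcons inE qks orbT.
Qed.

Lemma filtration_nil_zero E : filtration A E [::] -> is_zero E.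
Proof. by move=> /filtration_hom0_l E0; exact/hom0_refl/E0. Qed.

Lemma filtration_decreasing E ks :
  filtration A E ks -> pairwise (fun p q => q < p) ks.
Proof.
by elim=> {E ks} // E' E A' ks p f g h _ IH ksp _ _ _; rewrite pairwise_rcons ksp.
Qed.

Hypothesis hA : is_heart A.

Lemma heart_hom0 B C p q : A B -> A C -> q < p -> hom0 (tshift p B) (tshift q C).
Proof. by move=> AB AC qp f; have [_ + _] := hA; exact. Qed.

Lemma heart_filtration E : ~ is_zero E -> exists ks, filtration A E ks.
Proof. by have [_ _] := hA; exact. Qed.

Lemma filtration_cons_le E p ks t : filtration A E (p :: ks) -> hom_above t E -> p <= t.
Proof.
have: (0 < size (p :: ks))%N by [].
rewrite -[p in p <= t]/(head 0 (p :: ks)); move: (p :: ks) => l l0 El.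
elim: El t l0 => {E l} // E' E A' ks' r f g h E'ks IH ksr AA' A'0 fgh t _ Et.
case: ks' E'ks IH ksr => [E'0 _ _ /=|q ks' E'ks IH /= /andP[rq _]].
  rewrite leNgt; apply/negP => tr; apply: A'0; apply: (@is_zero_tshift r).
  apply: is_zeroP; have sE'0 : is_zero (shift1 E' : D).
    by apply: functor_is_zero; exact: filtration_nil_zero.
  have [|v ->] := exact_lift (w := idm (tshift r A')) (proj1 (exact_rot _ _ _) fgh).
    exact: hom_to_zero.
  by rewrite (Et _ _ AA' tr v) compm0.
(* The leading index belongs to E', but injectivity of Hom(B[u], E') -> Hom(B[u], E) is only
   guaranteed for u > r - 1, so the bound weakens to max(t, r - 1). Since r < q, the inequality q <=
   max(t, r - 1) still yields q <= t. *)
suff E't : hom_above (Num.max t (r - 1)) E'.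
  by have := IH _ isT E't; rewrite le_max => /orP[//|/=]; lia.
move=> B u AB; rewrite gt_max => /andP[tu ru] w.
apply: (exact_mono fgh); last exact: Et.
apply: (hom0_iso (isomorphic_sym (shift_tshift _ _)) (isomorphic_refl _)).
by apply: heart_hom0 => //; lia.
Qed.

(** If p < t, the last map E -> A_m[p] is zero, so the identity of A_m[p] factors through E'[1]. All
    factors of E'[1] have shift above p, so they have no maps to A_m[p], which would then be
    zero. *)
Lemma filtration_rcons_ge E p ks t :
  filtration A E (rcons ks p) -> hom_below t E -> t <= p.
Proof.
move: {-2}(rcons ks p) (erefl (rcons ks p)) => l lE El; case: El ks p lE => {E l}.
  by move=> E _ [].
move=> E' E A' ks r f g h E'ks ksr AA' A'0 fgh ks' p /rcons_inj[_ <-] Et.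
rewrite leNgt; apply/negP => rt; apply: A'0; apply: (@is_zero_tshift r).
have g0 : g = 0 by exact: Et.
have [|c idE] := exact_extend (y := idm (tshift r A')) (proj1 (exact_rot _ _ _) fgh).
  by rewrite g0 compm0.
suff c0 : hom0 (shift1 E') (tshift r A') by apply: is_zeroP; rewrite idE (c0 c) comp0m.
have := @hom0_tshift 1 0 (r - 1) E' A'; rewrite subrK => -[+ _]; apply.
apply: (filtration_hom0_l E'ks _) => q B qks AB; apply: heart_hom0 => //.
by have := allP ksr _ qks; lia.
Qed.

Lemma filtration_above E ks t : filtration A E ks -> {in ks, forall q, q <= t} ->
  hom_above t E.
Proof.
move=> Eks kt B p AB tp; apply: (filtration_hom0_r Eks _) => q C qks AC.
by apply: heart_hom0 => //; exact: le_lt_trans (kt _ qks) tp.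
Qed.

Lemma filtration_below E ks t : filtration A E ks -> {in ks, forall q, t <= q} ->
  hom_below t E.
Proof.
move=> Eks kt B p AB pt; apply: (filtration_hom0_l Eks _) => q C qks AC.
by apply: heart_hom0 => //; exact: lt_le_trans pt (kt _ qks).
Qed.

(** All indices in the filtration of E are at least s, hence above t, so every factor maps trivially
    to E'. *)
Lemma hom_below_above s t E E' : hom_below s E -> hom_above t E' -> t < s ->
  hom0 E E'.
Proof.
move=> Es E't ts; have [E0|/heart_filtration[ks Eks]] := pselect (is_zero E).
  by move=> f; exact: hom_from_zero.
apply: (filtration_hom0_l Eks _) => p B pks AB; apply: E't => //.
apply: lt_le_trans ts _; case/lastP: ks Eks pks => // ks r Eks.
have sr := filtration_rcons_ge Eks Es.
rewrite mem_rcons inE => /orP[/eqP -> //|pks].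
apply: le_trans sr _; apply: ltW; have := filtration_decreasing Eks.
by rewrite pairwise_rcons => /andP[/allP/(_ _ pks)].
Qed.

Lemma phi_plusP E : ~ is_zero E -> forall t, hom_above t E <-> phi_plus A E <= t.
Proof.
move=> E0; rewrite /phi_plus; case: xgetP => [p -> [ks Eks] t|np]; last first.
  have [[|p ks] Eks] := heart_filtration E0; first by case: E0; exact: filtration_nil_zero.
  by case: (np p); exists ks.
split=> [|pt]; first exact: (filtration_cons_le Eks).
apply: (filtration_above Eks _) => q; rewrite inE => /orP[/eqP -> //|qks].
apply: (le_trans _ pt); apply: ltW; have /= := filtration_decreasing Eks.
by move=> /andP[/allP/(_ _ qks)].
Qed.

Lemma phi_minusP E : ~ is_zero E -> forall t, hom_below t E <-> t <= phi_minus A E.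
Proof.
move=> E0; rewrite /phi_minus; case: xgetP => [p -> [ks Eks] t|np]; last first.
  have [ks Eks] := heart_filtration E0; case/lastP: ks Eks => [|ks p] Eks.
    by case: E0; exact: filtration_nil_zero.
  by case: (np p); exists ks.
split=> [|tp]; first exact: (filtration_rcons_ge Eks).
apply: (filtration_below Eks _) => q; rewrite mem_rcons inE => /orP[/eqP -> //|qks].
apply: le_trans tp _; apply: ltW; have := filtration_decreasing Eks.
by rewrite pairwise_rcons => /andP[/allP/(_ _ qks)].
Qed.

Lemma is_zero_hom_above E : is_zero E -> forall t, hom_above t E.
Proof. by move=> E0 t B p _ _ f; exact: hom_to_zero. Qed.

Lemma is_zero_hom_below E : is_zero E -> forall t, hom_below t E.
Proof. by move=> E0 t B p _ _ f; exact: hom_from_zero. Qed.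

Lemma hom_above_ex E : exists t, hom_above t E.
Proof.
have [E0|E0] := pselect (is_zero E); first by exists 0; exact: is_zero_hom_above.
by exists (phi_plus A E); apply/(phi_plusP E0).
Qed.

Lemma hom_below_ex E : exists t, hom_below t E.
Proof.
have [E0|E0] := pselect (is_zero E); first by exists 0; exact: is_zero_hom_below.
by exists (phi_minus A E); apply/(phi_minusP E0).
Qed.

Lemma phi_minus_le_plus E : ~ is_zero E -> phi_minus A E <= phi_plus A E.
Proof.
move=> E0; rewrite leNgt; apply/negP => lt; apply: (E0); apply: hom0_refl.
by apply: hom_below_above lt; [apply/(phi_minusP E0)|apply/(phi_plusP E0)].
Qed.

End Hearts.

(** * Ghosts and objects of bounded ghost length *)

Section Ghosts.
Variables (k : fieldType) (D : triangulated k) (G : D).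
Implicit Types (X Y Z W : D) (p : int) (n m : nat).

Definition ghost X Y (u : hom D X Y) :=
  forall p (f : hom D (tshift p G) X), u \c f = 0.

(** For n = 0 every morphism is allowed, so this is a composite of n ghosts followed by an arbitrary
    map. In this form each class is closed under composition on both sides. *)
Fixpoint nghost n X Y (u : hom D X Y) : Prop :=
  if n is m.+1 then exists Z (v : hom D X Z) (w : hom D Z Y),
    [/\ ghost v, nghost m w & u = w \c v]
  else True.

Lemma nghost_precomp n X Y Z (u : hom D Y Z) (v : hom D X Y) :
  nghost n u -> nghost n (u \c v).
Proof.
case: n => // n [W [v' [w [v'g wg ->]]]]; exists W, (v' \c v), w; split=> //.
  by move=> p f; rewrite -compA; exact: v'g.
by rewrite compA.
Qed.

Lemma nghost_postcomp n X Y Z (u : hom D X Y) (v : hom D Y Z) :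
  nghost n u -> nghost n (v \c u).
Proof.
elim: n X u => // n IH X u [W [v' [w [v'g wg ->]]]].
by exists W, v', (v \c w); split; [|exact: IH|rewrite compA].
Qed.

Lemma nghost_split m n X Y (u : hom D X Y) : nghost (m + n) u ->
  exists Z (v : hom D X Z) (w : hom D Z Y),
    [/\ nghost m v, nghost n w & u = w \c v].
Proof.
elim: m X u => [|m IH] X u /=.
  by move=> ug; exists X, (idm X), u; rewrite compm1.
move=> [W [v [w [vg /IH[Z [v' [w' [v'g w'g ->]]]] ->]]]].
exists Z, (v' \c v), w'; split; [by exists W, v, v'|by []|by rewrite compA].
Qed.

Lemma ghost_iso p W X Y (u : hom D X Y) (f : hom D W X) :
  ghost u -> isomorphic W (tshift p G) -> u \c f = 0.
Proof.
move=> ug [a [a' [a'a _]]].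
by rewrite -(compm1 f) -a'a !compA -(compA u) ug comp0m.
Qed.

(** The conclusion of the ghost lemma for an object built from n shifts of G, up to direct
    summands. *)
Definition ghost_nil n Y := forall X X' (u : hom D X X'), nghost n u ->
  forall f : hom D Y X, u \c f = 0.

Lemma ghost_nil_iso n Y Y' : isomorphic Y Y' -> ghost_nil n Y -> ghost_nil n Y'.
Proof.
move=> [a [a' [_ aa']]] Yn X X' u un f.
by rewrite -(compm1 f) -aa' !compA -(compA u) (Yn _ _ _ un) comp0m.
Qed.

Lemma ghost_nil_retract n X Y (i : hom D X Y) (p : hom D Y X) :
  p \c i = idm X -> ghost_nil n Y -> ghost_nil n X.
Proof.
by move=> pi Yn Z Z' u un f; rewrite -(compm1 f) -pi !compA -(compA u) (Yn _ _ _ un) comp0m.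
Qed.

(** The first m ghosts kill the restriction to X, so the map factors through Z, where the remaining
    n ghosts kill it. *)
Lemma ghost_nil_exact m n X Y Z (f : hom D X Y) (g : hom D Y Z)
    (h : hom D Z (shift1 X)) :
  distinguished f g h -> ghost_nil m X -> ghost_nil n Z -> ghost_nil (m + n) Y.
Proof.
move=> fgh Xm Zn W W' _ /nghost_split[V [v [w [vm wn ->]]]] y.
have [|c vy] := exact_extend (y := v \c y) fgh.
  by rewrite -compA Xm.
by rewrite -compA vy compA Zn// comp0m.
Qed.

Lemma split_generator_ghost_nil : split_generator G ->
  forall Y, exists n, ghost_nil n Y.
Proof.
move=> Ggen Y; have [Y' [B [[i [_ [p [_ [pi _ _ _ _]]]]] GB]]] := Ggen Y.
suff [n Bn] : exists n, ghost_nil n B by exists n; exact: ghost_nil_retract pi Bn.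
elim: {Y Y' i p pi} B / GB => [B B0|B' B p f g h _ [n B'n] fgh].
  by exists 0%N => X X' u _ f; rewrite (hom_from_zero f B0) compm0.
exists (n + 1)%N; apply: (ghost_nil_exact fgh B'n) => X X' _ [Z [v [w [vg _ ->]]]] y.
by rewrite -compA vg compm0.
Qed.

Section GhostEquivalence.
Variables (P P' : linfunctor D D) (PP' : quasi_inverse P P').
Hypothesis PG : forall p, exists q, isomorphic (P (tshift p G)) (tshift q G).

Let ghost_functor X Y (u : hom D X Y) : ghost u -> ghost (fhom P' u).
Proof.
move=> ug p f; have [P'P [t [ti tn]]] := PP'.
apply: (faithful_of_retraction P'P); rewrite linear0 fhom_comp.
have [t' [t't _]] := ti Y.
have [q Gq] := PG p.
have /= tu := tn X Y u.
rewrite -[LHS]comp1m -t't -compA [X in _ \c X]compA tu -compA.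
by rewrite (ghost_iso _ ug Gq) compm0.
Qed.

Let nghost_functor n X Y (u : hom D X Y) : nghost n u -> nghost n (fhom P' u).
Proof.
elim: n X u => // n IH X u [Z [v [w [vg wn ->]]]].
exists (P' Z), (fhom P' v), (fhom P' w).
by rewrite fhom_comp; split=> //; [exact: ghost_functor|exact: IH].
Qed.

(** Maps G[p] -> P' X correspond to maps P(G[p]) -> X, and P permutes the shifts of G up to
    isomorphism; hence P' preserves ghosts. Maps P Y -> X are then tested after applying P'. *)
Lemma ghost_nil_functor n Y : ghost_nil n Y -> ghost_nil n (P Y).
Proof.
move=> Yn X X' u un f; have [P'P PP't] := PP'.
apply: (faithful_of_retraction PP't); rewrite linear0 fhom_comp.
have [t [ti _]] := P'P; have [t' [t't _]] := ti Y.
rewrite -[LHS]compm1 -t't compA -(compA (fhom P' u)).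
by rewrite (Yn _ _ _ (nghost_functor un)) comp0m.
Qed.

End GhostEquivalence.

Lemma ghost_nil_shift n Y : ghost_nil n Y <-> ghost_nil n (shift1 Y).
Proof.
split; first apply: (ghost_nil_functor (shift1K D)) => p.
  by exists (p + 1); exact: shift_tshift.
move=> /(ghost_nil_functor (quasi_inverse_sym (shift1K D))) H.
apply: (ghost_nil_iso (unshift_shift Y)); apply: H => p.
by exists (p - 1); exact: unshift_tshift.
Qed.

End Ghosts.

(** * Bilinear maps and tensor products *)

Section Bilinear.
Variables (k : fieldType) (U V W : lmodType k) (b : U -> V -> W).
Hypothesis bb : bilin b.

Let fl v : {linear U -> W} := linear_fun (bb.1 v).
Let fr u : {linear V -> W} := linear_fun (bb.2 u).

Lemma bilinDl u u' v : b (u + u') v = b u v + b u' v.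
Proof. exact: (linearD (fl v)). Qed.
Lemma bilinBl u u' v : b (u - u') v = b u v - b u' v.
Proof. exact: (linearB (fl v)). Qed.
Lemma bilinZl a u v : b (a *: u) v = a *: b u v.
Proof. by rewrite -[LHS]/(fl v _) linearZ. Qed.
Lemma bilin0l v : b 0 v = 0.
Proof. exact: (linear0 (fl v)). Qed.
Lemma bilinDr u v v' : b u (v + v') = b u v + b u v'.
Proof. exact: (linearD (fr u)). Qed.
Lemma bilinBr u v v' : b u (v - v') = b u v - b u v'.
Proof. exact: (linearB (fr u)). Qed.
Lemma bilinZr a u v : b u (a *: v) = a *: b u v.
Proof. by rewrite -[LHS]/(fr u _) linearZ. Qed.
Lemma bilin0r u : b u 0 = 0.
Proof. exact: (linear0 (fr u)). Qed.

Lemma bilin_comp_linear (W' : lmodType k) (f : {linear W -> W'}) :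
  bilin (fun u v => f (b u v)).
Proof.
by split=> [v a u u'|u a v v']; rewrite ?bilinDl ?bilinZl ?bilinDr ?bilinZr linearP.
Qed.

End Bilinear.

Lemma tensor_ext (k : fieldType) (U V T W : lmodType k) (t : U -> V -> T)
    (f g : {linear T -> W}) :
  is_tensor t -> (forall u v, f (t u v) = g (t u v)) -> f =1 g.
Proof.
move=> [tb tu] fg x; have [h [_ hu]] := tu W _ (bilin_comp_linear tb g).
by rewrite (hu f fg) (hu g).
Qed.

(** * Null-homotopies compatible with Koszul signs *)

Section GradedHomotopy.
Variable k : fieldType.
Implicit Types V W : complex k.

Definition sign_operator W (s : {linear W -> W}) :=
  forall n x, hdeg W n x -> s x = ksign k n *: x.

Lemma ksign_mul n : ksign k n * ksign k n = 1.
Proof. by rewrite /ksign -expr2 sqrr_sign. Qed.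

Lemma odd_abs_succ (n : int) : odd `|(n + 1)%R|%N = ~~ odd `|n|%N.
Proof. lia. Qed.

Lemma graded_null_homotopy V W (g : {linear V -> W}) :
  (forall n x, hdeg V n x -> hdeg W n (g x)) ->
  (forall x, g (dif x) = dif (g x)) ->
  (forall x, dif x = 0 -> exists y, g x = dif y) ->
  exists (h : {linear V -> W}) (s : {linear W -> W}),
    [/\ sign_operator s, forall x, dif (h x) + h (dif x) = g x
      & forall n x, hdeg V n x -> s (h x) = - (ksign k n *: h x)].
Proof.
move=> gdeg gdif g0.
have [h hP] := null_on_cohomology_homotopy (@difK k V) gdif g0.
have [e eP] := parity_projection V; have [e' eP'] := parity_projection W.
have edif x : e' (dif x) = dif x - dif (e' x).
  elim/hdeg_ind: x => [n x Wx|x y xE yE]; last first.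
    by rewrite !linearD xE yE /= addrACA.
  rewrite (eP' _ _ Wx) (eP' _ _ (dif_deg Wx)) odd_abs_succ.
  by case: odd => /=; [rewrite linear0 subr0|rewrite subrr].
have e'K x : e' (e' x) = e' x.
  elim/hdeg_ind: x => [n x Wx|x y xE yE]; last by rewrite !linearD /= xE yE.
  by rewrite (eP' _ _ Wx); case: ifP => o; rewrite ?linear0// (eP' _ _ Wx) o.
(* The parity-reversing part of [h]. Since [g] preserves parity and the differential reverses it,
   this part alone is still a null-homotopy of [g], and it anticommutes with the sign operator. *)
have [h' h'E] : exists h' : {linear V -> W},
    forall x, h' x = e' (h (x - e x)) + (h (e x) - e' (h (e x))).
  by exists ((e' \o (h \o (idfun \- e))) \+ ((h \o e) \- (e' \o (h \o e)))).
have [s sE] : exists s : {linear W -> W}, forall x, s x = e' x + e' x - x.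
  by exists ((e' \+ e') \- idfun).
have sP : sign_operator s.
  move=> n x Wx; rewrite sE (eP' _ _ Wx) /ksign -signr_odd.
  case: odd; first by rewrite expr1 scaleN1r addr0 sub0r.
  by rewrite expr0 scale1r addrK.
have h'_even x : e x = x -> h' x = h x - e' (h x).
  by move=> ex; rewrite h'E ex subrr !linear0 add0r.
have h'_odd x : e x = 0 -> h' x = e' (h x).
  by move=> ex; rewrite h'E ex subr0 !linear0 ?oppr0 !addr0.
exists h', s; split=> // [x|n x Vx]; last first.
  rewrite sE /ksign -signr_odd; have := eP _ _ Vx; case: odd => ex.
    by rewrite h'_odd// e'K addrK expr1 scaleN1r opprK.
  have e'h : e' (h x - e' (h x)) = 0 by rewrite linearB /= e'K subrr.
  by rewrite h'_even// e'h !add0r expr0 scale1r.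
elim/hdeg_ind: x => [n x Vx|x y xE yE]; last first.
  by rewrite !linearD /= addrACA xE yE.
have := eP' _ _ (gdeg _ _ Vx); rewrite -hP linearD /= edif.
have := eP _ _ Vx; have := eP _ _ (dif_deg Vx); rewrite odd_abs_succ.
case: odd => /= edx ex.
  rewrite h'_odd// h'_even// => /eqP; rewrite addrAC subr_eq0 => /eqP <-.
  by rewrite -addrA [X in _ + X]addrCA subrr addr0.
by rewrite (h'_even x)// (h'_odd (dif x))// linearB.
Qed.

End GradedHomotopy.

(** * Composition and shifts in a dg category *)

Section DgShift.
Variables (k : fieldType) (C : dgcat k).
Implicit Types X Y Z W : C.

Lemma dcompBl X Y Z (g g' : dhom C Y Z) (f : dhom C X Y) :
  (g - g') \dc f = g \dc f - g' \dc f.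
Proof. exact: (bilinBl (dcomp_bilin X Y Z)). Qed.
Lemma dcompBr X Y Z (g : dhom C Y Z) (f f' : dhom C X Y) :
  g \dc (f - f') = g \dc f - g \dc f'.
Proof. exact: (bilinBr (dcomp_bilin X Y Z)). Qed.
Lemma dcomp0l X Y Z (f : dhom C X Y) : (0 : dhom C Y Z) \dc f = 0.
Proof. exact: (bilin0l (dcomp_bilin X Y Z)). Qed.
Lemma dcomp0r X Y Z (g : dhom C Y Z) : g \dc (0 : dhom C X Y) = 0.
Proof. exact: (bilin0r (dcomp_bilin X Y Z)). Qed.

Lemma dcomp_cocycle X Y Z m n (g : dhom C Y Z) (f : dhom C X Y) :
  cocycle m g -> cocycle n f -> cocycle (m + n) (g \dc f).
Proof.
move=> [gm dg] [fn df]; split; first exact: dcomp_deg.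
by rewrite (dcomp_dif _ gm) dg df dcomp0l dcomp0r scaler0 addr0.
Qed.

Lemma dcomp_difl X Y Z n (h : dhom C Y Z) (f : dhom C X Y) :
  hdeg (dhom C Y Z) n h -> dif f = 0 -> dif h \dc f = dif (h \dc f).
Proof. by move=> hn df; rewrite (dcomp_dif _ hn) df dcomp0r scaler0 addr0. Qed.

Lemma dcomp_difr X Y Z n (g : dhom C Y Z) (h : dhom C X Y) :
  cocycle n g -> g \dc dif h = dif (ksign k n *: (g \dc h)).
Proof.
move=> [gn dg]; rewrite linearZ /= (dcomp_dif _ gn) dg dcomp0l add0r.
by rewrite scalerA ksign_mul scale1r.
Qed.

(* [X], up to homotopy, is the shift of [Y] by [n]. *)
Definition dg_shift_by n X Y := exists (v : dhom C X Y) (u : dhom C Y X),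
  [/\ cocycle (- n) v, cocycle n u & exists w, v \dc u - did Y = dif w].

Lemma dg_shift_by0 X : dg_shift_by 0 X X.
Proof.
exists (did X), (did X); rewrite oppr0; split; try exact: did_deg.
by exists 0; rewrite dcomp1m subrr linear0.
Qed.

Lemma dg_shift_by_trans n m X Y Z w (v : dhom C X Y) (u : dhom C Y X) :
  dg_shift_by n Y Z -> cocycle (- m) v -> cocycle m u ->
  hdeg (dhom C Y Y) (- 1) w -> v \dc u - did Y = dif w ->
  dg_shift_by (n + m) X Z.
Proof.
move=> [v' [u' [v'n u'n [w' v'u']]]] vm um w1 vu.
exists (v' \dc v), (u \dc u'); split.
- by rewrite opprD; exact: dcomp_cocycle.
- by rewrite addrC; exact: dcomp_cocycle.
(* From v'(vu)u' - 1 = v'(vu - 1)u' + (v'u' - 1); the sign comes from moving the differential past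
   v'. *)
exists (ksign k (- n) *: (v' \dc (w \dc u')) + w').
rewrite linearD /= -(dcomp_difr _ v'n) -v'u' -(dcomp_difl w1); last by case: u'n.
by rewrite -vu !(dcompBl, dcompBr) dcomp1m !dcompA addrA subrK.
Qed.

End DgShift.

(** * Ghosts lifted to the enhancement and acting on bimodules *)

Section Smoothness.
Variables (k : fieldType) (D : triangulated k) (C : dgcat k) (Phi : enhancement D C).
Implicit Types X Y Z W : C.

(** The class of [v] gives Phi Y -> (Phi X)[1]. As [enh0] and [enh1] do not describe maps out of a
    shift, the inverse is built through an object T with Phi T isomorphic to (Phi X)[1]. *)
Lemma enh_shift X Y : is_dg_shift X Y -> isomorphic (Phi Y) (shift1 (Phi X)).
Proof.
move=> [u [v [u1 v1 [w [w1 vu]] [w' [w1' uv]]]]].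
have [T [a [a' [a'a aa']]]] := enh_esurj Phi (shift1 (Phi X)).
have [t t1 ta] := enh1_full a.
have ut0 : cocycle 0 (u \dc t) by exact: (dcomp_cocycle u1 t1).
pose r := enh0 Phi T Y (u \dc t) \c a'.
have vr : enh1 Phi Y X v \c r = idm _.
  rewrite /r compA -(enh1_compr _ v1 ut0) -aa' -ta; congr (_ \c _).
  apply/eqP; rewrite -subr_eq0 -linearB; apply/eqP/(enh1_faithful Phi).
    have [vt1 dvt] := dcomp_cocycle v1 ut0; have [t1' dt] := t1.
    split; last by rewrite linearB /= dvt dt subrr.
    by apply: hdeg_add; [exact: vt1|exact: hdeg_opp].
  exists (w \dc t); rewrite -(dcomp_difl w1); last by case: t1.
  split; last by rewrite -vu dcompBl dcomp1m dcompA.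
  by case: t1 => t1 _; exact: (dcomp_deg w1 t1).
exists (enh1 Phi Y X v), r; split=> //.
have [f [f0 df] fE] := enh0_full (r \c enh1 Phi Y X v - idm _).
have : enh1 Phi Y X v \c enh0 Phi Y Y f = 0.
  by rewrite fE compmB compA vr comp1m compm1 subrr.
rewrite -(enh1_compr _ v1)// => /(enh1_faithful Phi)[|z [z0 vfz]].
  exact: (dcomp_cocycle v1 (conj f0 df)).
apply/eqP; rewrite -subr_eq0 -fE; apply/eqP/(enh0_faithful Phi) => //.
apply: (@coboundaryP _ _ _ _ (ksign k (- 1) *: (u \dc z) - w' \dc f)) => //.
by rewrite linearB /= -(dcomp_difr _ u1) -vfz -(dcomp_difl w1')// -uv dcompBl dcomp1m dcompA subKr.
Qed.

Lemma dg_shift_ghost_nil G m X : pretriangulated C -> ghost_nil G m (Phi X) ->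
  forall n, exists Y, dg_shift_by n Y X /\ ghost_nil G m (Phi Y).
Proof.
move=> [_ Cs Cu _] Xm; elim/int_ind => [|n [Y [YX Ym]]|n [Y [YX Ym]]].
- by exists X; split=> //; exact: dg_shift_by0.
- have [Z ZY] := Cu Y; exists Z; split; last first.
    by apply: (proj2 (ghost_nil_shift _ _ _)); apply: ghost_nil_iso Ym; exact: enh_shift.
  have [u [v [u1 v1 _ [w [w1 uv]]]]] := ZY.
  by rewrite intS addrC; exact: dg_shift_by_trans YX u1 v1 w1 uv.
- have [Z YZ] := Cs Y; exists Z; split; last first.
    apply: (ghost_nil_iso (isomorphic_sym (enh_shift YZ))).
    exact: (proj1 (ghost_nil_shift _ _ _)).
  have [u [v [u1 v1 [w [w1 vu]] _]]] := YZ.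
  have -> : - n.+1%:Z = - n%:Z - 1 by lia.
  exact: (dg_shift_by_trans (m := - 1) YX v1 u1 w1 vu).
Qed.

(** The enhancement compares cohomology with D only in degrees 0 and 1, so a cocycle of degree m is
    first moved to degree 0 by replacing X with a shift, which has the same ghost length. *)
Lemma ghost_nil_dg G n X : pretriangulated C -> ghost_nil G n (Phi X) ->
  forall W W' (g : dhom C W W'), cocycle 0 g -> nghost G n (enh0 Phi W W' g) ->
  forall b : dhom C X W, dif b = 0 -> exists y, g \dc b = dif y.
Proof.
move=> Cp Xn W W' g g0 gn; apply: cocycle_ind => [|m b bm|b b' [y yE] [y' yE']].
- by exists 0; rewrite dcomp0r linear0.
- have [Y [[v [u [vm um [w vu]]]] Yn]] := dg_shift_ghost_nil Cp Xn m.
  have bv0 : cocycle 0 (b \dc v) by have := dcomp_cocycle bm vm; rewrite subrr.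
  have [y [y1 gbv]] : coboundary 0 (g \dc (b \dc v)).
    apply/(enh0_faithful Phi); first exact: (dcomp_cocycle g0 bv0).
    by rewrite enh0_comp//; exact: (Yn _ _ _ gn).
  (* With vu - 1 = dw and g b v = dy, one has g b = g b v u - g b (vu - 1) = d(y u) - g b dw. *)
  exists (y \dc u - ksign k 0 *: (g \dc (ksign k m *: (b \dc w)))).
  rewrite linearB /= -(dcomp_difr _ g0) -(dcomp_difr _ bm) -vu.
  rewrite -(dcomp_difl y1); last by case: um.
  by rewrite -gbv !dcompBr dcompm1 !dcompA subKr.
- by exists (y + y'); rewrite linearD -yE -yE' (bilinDr (dcomp_bilin _ _ _)).
Qed.

Section Action.
Variable M : dgbimod C.

Lemma lact_cocycle X Y Z (g : dhom C Y Z) (x : M X Y) : cocycle 0 g ->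
  dif (lact M g x) = lact M g (dif x).
Proof.
move=> [g0 dg]; rewrite (lact_dif _ g0) dg (bilin0l (lact_bilin M _ _ _)) add0r.
by rewrite /ksign expr0 scale1r.
Qed.

Lemma lact_coboundary X Y Z n (h : dhom C Y Z) (x : M X Y) :
  hdeg (dhom C Y Z) n h -> dif x = 0 -> lact M (dif h) x = dif (lact M h x).
Proof.
by move=> hn dx; rewrite (lact_dif _ hn) dx (bilin0r (lact_bilin M _ _ _)) scaler0 addr0.
Qed.

End Action.

Variable G : D.

Definition action_nil n (M : dgbimod C) := forall W W' (g : dhom C W W'),
  cocycle 0 g -> nghost G n (enh0 Phi W W' g) ->
  forall X (x : M X W), dif x = 0 -> exists y, lact M g x = dif y.

(** The intermediate object is replaced by one from C by essential surjectivity; faithfulness gives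
    the factorization only up to a coboundary. *)
Lemma nghost_split_dg m n W W' (g : dhom C W W') : cocycle 0 g ->
  nghost G (m + n) (enh0 Phi W W' g) ->
  exists Z (g1 : dhom C W Z) (g2 : dhom C Z W'),
    [/\ cocycle 0 g1 /\ cocycle 0 g2, nghost G m (enh0 Phi W Z g1),
        nghost G n (enh0 Phi Z W' g2) & coboundary 0 (g - g2 \dc g1)].
Proof.
move=> g0 /nghost_split[E [v [w [vm wn gE]]]].
have [Z [a [a' [a'a aa']]]] := enh_esurj Phi E.
have [g1 g10 g1E] := enh0_full (a' \c v).
have [g2 g20 g2E] := enh0_full (w \c a).
exists Z, g1, g2; split; [by []| | |].
- by rewrite g1E; exact: nghost_postcomp.
- by rewrite g2E; exact: nghost_precomp.
have [g12 dg12] := dcomp_cocycle g20 g10; have [g0' dg] := g0.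
apply/(enh0_faithful Phi).
  split; last by rewrite linearB /= dg dg12 subrr.
  by apply: hdeg_add => //; exact: hdeg_opp.
rewrite linearB /= enh0_comp// g1E g2E gE -(compA w) (compA a) aa' comp1m.
by rewrite subrr.
Qed.

Lemma action_split (M : dgbimod C) m n W W' (g : dhom C W W') : cocycle 0 g ->
  nghost G (m + n) (enh0 Phi W W' g) ->
  exists Z (g1 : dhom C W Z) (g2 : dhom C Z W'),
    [/\ cocycle 0 g1 /\ cocycle 0 g2, nghost G m (enh0 Phi W Z g1),
        nghost G n (enh0 Phi Z W' g2)
      & forall X (x : M X W), dif x = 0 ->
        exists y, lact M g x = lact M g2 (lact M g1 x) + dif y].
Proof.
move=> g0 /(nghost_split_dg g0)[Z [g1 [g2 [g12 g1m g2n [h [h1 hE]]]]]].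
exists Z, g1, g2; split=> // X x dx; exists (lact M h x).
rewrite lactA -(lact_coboundary h1)// -hE (bilinBl (lact_bilin M _ _ _)).
by rewrite addrC subrK.
Qed.

Lemma chain_map_lin (V V' : complex k) (f : V -> V') : chain_map f ->
  exists f' : {linear V -> V'}, f =1 f'.
Proof. by case=> fL _ _; exists (linear_fun fL). Qed.

Lemma quasi_iso_surj (V V' : complex k) (q : V -> V') : quasi_iso q ->
  forall y, dif y = 0 -> exists x z, dif x = 0 /\ q x - y = dif z.
Proof.
move=> [qc qs _]; have [f qf] := chain_map_lin qc.
apply: cocycle_ind => [|n y yn|y y' [x [z [dx xy]]] [x' [z' [dx' xy']]]].
- by exists 0, 0; rewrite qf subr0 !linear0.
- by have [x [_ dx] [z [_ xy]]] := qs _ _ yn; exists x, z.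
- exists (x + x'), (z + z'); rewrite !linearD dx dx' addr0; split=> //.
  by rewrite -xy -xy' !qf linearD addrACA.
Qed.

(** [quasi_iso] is stated degree by degree; projecting to components, with which q commutes, gives
    injectivity on total cohomology. *)
Lemma quasi_iso_inj (V V' : complex k) (q : V -> V') : quasi_iso q ->
  forall x y, dif x = 0 -> q x = dif y -> exists z, x = dif z.
Proof.
move=> [qc _ qi] x y dx qxy; have [f qf] := chain_map_lin qc.
have [c [ch cs cE c0]] := homogeneous_component V.
have [c' [ch' cs' cE' c0']] := homogeneous_component V'.
have fc n v : f (c n v) = c' n (f v).
  elim/hdeg_ind: v => [m v Vv|v v' vE vE']; last by rewrite !linearD /= vE vE'.
  have fv : hdeg V' m (f v) by rewrite -qf; exact: (chain_deg qc).
  have [->|nm] := eqVneq n m; first by rewrite cE// cE'.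
  by rewrite (c0 n m)// (c0' n m)// linear0.
have cob n : exists z, c n x = dif z.
  have [||z [_ ->]] := qi n (c n x); last by exists z.
    split=> //; have := component_dif cE c0 n x.
    by rewrite dx linear0.
  apply: (@coboundaryP _ _ _ _ (c' (n - 1) y)).
    exact: (chain_deg qc).
  by rewrite -(component_dif cE' c0') subrK -qxy qf fc qf.
have [s ->] := cs x; apply: (big_ind (fun v => exists z, v = dif z)) => //.
- by exists 0; rewrite linear0.
- by move=> _ _ [z ->] [z' ->]; exists (z + z'); rewrite linearD.
Qed.

End Smoothness.

(** * Smoothness implies that composites of sufficiently many ghosts vanish *)

Section StrongGeneration.
Variables (k : fieldType) (D : triangulated k) (C : dgcat k) (Phi : enhancement D C).
Variable G : D.

Let S (M : dgbimod C) := exists n, action_nil Phi G n M.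

Let cochain (M N : dgbimod C) (q : bimod_map M N) X Y (m : M X Y) :
  q X Y (dif m) = dif (q X Y m).
Proof. exact: chain_dif (bmap_chain q X Y) m. Qed.

Let S_qis (M N : dgbimod C) (q : bimod_map M N) : bimod_qis q -> (S M <-> S N).
Proof.
move=> qq; split=> -[n Mn]; exists n => W W' g g0 gn X x dx.
  have [m [z [dm qm]]] := quasi_iso_surj (qq X W) dx.
  have [m' gm] := Mn _ _ _ g0 gn _ _ dm.
  exists (q X W' m' - lact N g z).
  rewrite linearB /= -cochain -gm bmap_lact (lact_cocycle _ g0) -qm.
  by rewrite -(bilinBr (lact_bilin N _ _ _)) subKr.
have dqx : dif (q X W x) = 0.
  have [f qf] := chain_map_lin (bmap_chain q X W).
  by rewrite -cochain dx qf linear0.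
have [y gy] := Mn _ _ _ g0 gn _ _ dqx.
apply: (quasi_iso_inj (qq X W') (y := y)); last by rewrite bmap_lact.
by rewrite (lact_cocycle _ g0) dx (bilin0r (lact_bilin M _ _ _)).
Qed.

Let S_retract (M N : dgbimod C) (i : bimod_map M N) (r : bimod_map N M) :
  (forall X Y (m : M X Y), r X Y (i X Y m) = m) -> S N -> S M.
Proof.
move=> ri [n Nn]; exists n => W W' g g0 gn X x dx.
have [f if_] := chain_map_lin (bmap_chain i X W).
have [|y gy] := Nn _ _ _ g0 gn _ (i X W x).
  by rewrite -cochain dx if_ linear0.
by exists (r X W' y); rewrite -cochain -gy -bmap_lact ri.
Qed.

(** A chase in the long exact cohomology sequence. Split a composite of ghosts in two: the first
    factor kills the image of a class in the next group, so the result comes from the preceding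
    group, where the second factor kills it. *)
Let S_ses (L M N : dgbimod C) (i : bimod_map L M) (p : bimod_map M N) :
  bimod_ses i p -> [/\ S L -> S M -> S N, S L -> S N -> S M & S M -> S N -> S L].
Proof.
move=> ip.
have iL X Y := chain_map_lin (bmap_chain i X Y).
have pL X Y := chain_map_lin (bmap_chain p X Y).
have i_inj X Y l l' : i X Y l = i X Y l' -> l = l' by have [+ _ _] := ip X Y; exact.
have p_surj X Y n : exists m, p X Y m = n by have [_ + _] := ip X Y; exact.
have pi_ex X Y m : p X Y m = 0 -> exists l, i X Y l = m.
  by have [_ _ /(_ m)[+ _]] := ip X Y; exact.
have pi0 X Y l : p X Y (i X Y l) = 0.
  by have [_ _ /(_ (i X Y l))[_]] := ip X Y; apply; exists l.
have i0 X Y : i X Y 0 = 0 by have [f ->] := iL X Y; rewrite linear0.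
have p0 X Y : p X Y 0 = 0 by have [f ->] := pL X Y; rewrite linear0.
have iB X Y l l' : i X Y (l - l') = i X Y l - i X Y l'.
  by have [f fE] := iL X Y; rewrite !fE linearB.
have pB X Y m m' : p X Y (m - m') = p X Y m - p X Y m'.
  by have [f fE] := pL X Y; rewrite !fE linearB.
have pD X Y m m' : p X Y (m + m') = p X Y m + p X Y m'.
  by have [f fE] := pL X Y; rewrite !fE linearD.
split=> -[n1 H1] [n2 H2]; exists (n1 + n2)%N => W W' g g0 gn X x dx.
- have [Z [g1 [g2 [[g10 g20] g1n g2n gx]]]] := action_split N g0 gn.
  have [m pm] := p_surj _ _ x.
  (* The cocycle [l] represents the image of x under the connecting map. *)
  have [|l il] := pi_ex _ _ (dif m); first by rewrite cochain pm dx.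
  have dl : dif l = 0 by apply: i_inj; rewrite cochain il difK i0.
  have [l' gl] := H1 _ _ _ g10 g1n _ _ dl.
  have [|m' gm'] := H2 _ _ _ g20 g2n _ (lact M g1 m - i X Z l').
    by rewrite linearB /= (lact_cocycle _ g10) -il -bmap_lact gl cochain subrr.
  have [y ->] := gx _ _ dx; exists (p X W' m' + y); rewrite linearD -cochain -gm'.
  by congr (_ + _); rewrite bmap_lact pB pi0 subr0 bmap_lact pm.
(* Here the first factor has to act on N and the second on L, whence the exchange of n1 and n2. *)
- rewrite addnC in gn.
  have [Z [g1 [g2 [[g10 g20] g1n g2n gx]]]] := action_split M g0 gn.
  have [|y gy] := H2 _ _ _ g10 g1n _ (p X W x); first by rewrite -cochain dx p0.
  have [y' py'] := p_surj _ _ y.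
  have [|l il] := pi_ex _ _ (lact M g1 x - dif y').
    by rewrite pB bmap_lact gy cochain py' subrr.
  have dl : dif l = 0.
    apply: i_inj; rewrite cochain il linearB /= difK subr0 (lact_cocycle _ g10) dx.
    by rewrite (bilin0r (lact_bilin M _ _ _)) i0.
  have [l' gl] := H1 _ _ _ g20 g2n _ _ dl.
  have [z ->] := gx _ _ dx; exists (i X W' l' + lact M g2 y' + z).
  rewrite !linearD /= -cochain -gl bmap_lact il (lact_cocycle _ g20); congr (_ + _).
  by rewrite (bilinBr (lact_bilin M _ _ _)) subrK.
- have [Z [g1 [g2 [[g10 g20] g1n g2n gx]]]] := action_split L g0 gn.
  have [|m gm] := H1 _ _ _ g10 g1n _ (i X W x); first by rewrite -cochain dx i0.
  (* Since g1 x becomes a coboundary dm in M, it is the connecting image of the cocycle p m of N. *)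
  have [|n gpm] := H2 _ _ _ g20 g2n _ (p X Z m).
    by rewrite -cochain -gm -bmap_lact pi0.
  have [m2 pm2] := p_surj _ _ n.
  have [|l il] := pi_ex _ _ (lact M g2 m - dif m2).
    by rewrite pB bmap_lact gpm cochain pm2 subrr.
  have [z ->] := gx _ _ dx; exists (l + z); rewrite linearD; congr (_ + _).
  apply: i_inj; rewrite !bmap_lact cochain il linearB /= difK subr0.
  by rewrite (lact_cocycle _ g20) -gm.
Qed.

(** P(Z, -) is Hom(Y, -) tensor Hom(Z, X), and g acts on the left factor only. Over a field the
    action on Hom(Y, -), being zero on cohomology, is null-homotopic, and tensoring the homotopy
    with the identity gives one on P. *)
Let S_representable (P : dgbimod C) X Y : pretriangulated C -> split_generator G ->
  representable P X Y -> S P.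
Proof.
move=> Cp Gg [e [[e0 de] tens]].
have [n Yn] := split_generator_ghost_nil Gg (Phi Y).
exists n => W W' g g0 gn Z x dx.
pose gl : {linear dhom C Y W -> dhom C Y W'} :=
  linear_fun (proj2 (dcomp_bilin Y W W') g).
have [h [s [sP hP sh]]] : exists (h : {linear dhom C Y W -> dhom C Y W'})
    (s : {linear dhom C Y W' -> dhom C Y W'}),
    [/\ sign_operator s, forall b, dif (h b) + h (dif b) = gl b
      & forall n b, hdeg (dhom C Y W) n b -> s (h b) = - (ksign k n *: h b)].
  apply: graded_null_homotopy => [m b bm|b|b db].
  - by have := dcomp_deg (proj1 g0) bm; rewrite add0r.
  - have [g00 dg] := g0.
    by rewrite /= (dcomp_dif _ g00) dg dcomp0l add0r /ksign expr0 scale1r.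
  - exact: (ghost_nil_dg Cp Yn g0 gn db).
pose t V (b : dhom C Y V) (a : dhom C Z X) := lact P b (ract P e a).
have tbil V : bilin (t V) by case: (tens Z V).
have difea a : dif (ract P e a) = ract P e (dif a).
  rewrite (ract_dif _ e0) de (bilin0l (ract_bilin P _ _ _)) add0r.
  by rewrite /ksign expr0 scale1r.
have dift (b : dhom C Y W') a : dif (t _ b a) = t _ (dif b) a + t _ (s b) (dif a).
  elim/hdeg_ind: b => [j b bj|b b' bE bE'].
    by rewrite /t (lact_dif _ bj) (sP _ _ bj) difea (bilinZl (lact_bilin P _ _ _)).
  by rewrite !linearD !(bilinDl (tbil _)) linearD bE bE' addrACA.
(* [H] is h tensor 1, from the universal property. *)
have [H [Ht _]] := (tens Z W).2 _ (fun b a => t _ (h b) a)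
  (conj (fun a => (fun c u v => etrans (congr1 (t W' ^~ a) (linearP h c u v)) (proj1 (tbil W') a c _ _)))
        (fun b => proj2 (tbil W') (h b))).
have gL : linear (lact P g : P Z W -> P Z W') := proj2 (lact_bilin P Z W W') g.
(* On b tensor a, the two terms containing h b and da cancel because [s] anticommutes with [h]; the
   rest is (dh + hd)(b) tensor a. *)
have HE : (dif \o H) \+ (H \o dif) =1 linear_fun gL.
  apply: (tensor_ext (tens Z W)) => b a.
  elim/hdeg_ind: b => [j b bj|b b' bE bE'].
    have tE : dif (t W b a) = t W (dif b) a + ksign k j *: t W b (dif a).
      by rewrite /t (lact_dif _ bj) difea.
    rewrite /= -/(t W b a) tE linearD linearZ /= !Ht dift (sh _ _ bj).
    rewrite -scaleNr (bilinZl (tbil _)) scaleNr addrACA addNr addr0.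
    by rewrite -(bilinDl (tbil _)) hP /t -lactA.
  have -> : lact P (b + b') (ract P e a) = t W b a + t W b' a.
    exact: bilinDl (tbil W) _ _ _.
  by rewrite !linearD bE bE'.
by exists (H x); have := HE x; rewrite /= dx linear0 addr0 => ->.
Qed.

Hypotheses (Cp : pretriangulated C) (Cs : smooth_dg C) (Gg : split_generator G).

(** The diagonal lies in the class [S]. Acting on the class of the identity of X, a composite of n
    ghosts returns itself, which must therefore be a coboundary. *)
Lemma smooth_ghost_nilpotent : exists n, forall X Y (u : hom D X Y), nghost G n u -> u = 0.
Proof.
have [n nP] : S (diagonal_bimod C).
  apply: Cs => [|P X Y]; last exact: S_representable.
  by split; [exact: S_qis|exact: S_ses|exact: S_retract].
exists n => E E' u un.
have [X [a [a' [a'a aa']]]] := enh_esurj Phi E.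
have [Y [b [b' [b'b bb']]]] := enh_esurj Phi E'.
have [g g0 gE] := enh0_full (b' \c u \c a).
suff g00 : enh0 Phi X Y g = 0.
  have : b \c (b' \c u \c a) \c a' = 0 by rewrite -gE g00 compm0 comp0m.
  by rewrite -!compA aa' compm1 compA bb' comp1m.
apply/(enh0_faithful Phi) => //.
have [||y gy] := nP _ _ g g0 _ _ (did X).
- by rewrite gE; apply: nghost_precomp; exact: nghost_postcomp.
- by have [] := did_deg X.
by apply: (@coboundaryP _ _ _ _ y); [have [] := g0|rewrite -gy /= dcompm1].
Qed.

End StrongGeneration.

Lemma saturated_ghost_nilpotent (k : fieldType) (D : triangulated k) (G : D) :
  saturated D -> split_generator G ->
  exists n, forall X Y (u : hom D X Y), nghost G n u -> u = 0.
Proof.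
move=> [C [Cp _ Cs [Phi]]] Gg; exact: (@smooth_ghost_nilpotent k D C Phi G Cp Cs Gg).
Qed.

(** * Universal ghosts obtained by attaching shifts of G *)

Section Cells.
Variables (k : fieldType) (D : triangulated k) (G : D).
Implicit Types (X Y Z E : D) (p q t a : int) (P Q : int -> Prop).

Let az := @all_zero_surjection_closed k.

Inductive cellular P : forall X Y, hom D X Y -> Prop :=
| cellular_id X : cellular P (idm X)
| cellular_step X Y Z p (u : hom D X Y) (f : hom D (tshift p G) Y)
    (g : hom D Y Z) (h : hom D Z (shift1 (tshift p G))) :
    P p -> cellular P u -> distinguished f g h -> cellular P (g \c u).

Lemma cellular_sub P Q X Y (u : hom D X Y) : (forall p, P p -> Q p) ->
  cellular P u -> cellular Q u.
Proof.
move=> PQ; elim=> {X Y u} [X|X Y Z p u f g h Pp _ IH fgh]; first exact: cellular_id.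
exact: cellular_step (PQ _ Pp) IH fgh.
Qed.

Lemma cellular_comp P X Y Z (u : hom D X Y) (v : hom D Y Z) :
  cellular P v -> cellular P u -> cellular P (v \c u).
Proof.
move=> vP; elim: vP X u => {Y Z v} [Y X u|Y Z W p v f g h Pp _ IH fgh X u uP].
  by rewrite comp1m.
by rewrite -compA; exact: cellular_step Pp (IH _ _ uP) fgh.
Qed.

Definition supp_in P X := forall p, ~ P p -> hom0 (tshift p G) X.

(** The cone of G[p] -> Y adds to Y only maps into G[p + 1]. *)
Lemma cellular_supp P Q X Y (u : hom D X Y) :
  (forall p q, P p -> ~ Q q -> hom0 (tshift q G) (tshift (p + 1) G)) ->
  cellular P u -> supp_in Q X -> supp_in Q Y.
Proof.
move=> PQ; elim=> {X Y u} // X Y Z p u f g h Pp _ IH fgh XQ q Qq.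
apply: (exact_hom0_r (proj1 (exact_rot _ _ _) fgh)); first exact: IH.
by apply: (hom0_iso (isomorphic_refl _) (isomorphic_sym (shift_tshift _ _))); exact: PQ.
Qed.

Hypothesis hft : finite_type D.

Lemma fin_dim_tshift p X : fin_dim (hom D (tshift p G) X).
Proof.
have [/(_ (- p)) XG _] := hft G X.
have := hom_tshift (@fin_dim_surjection_closed k) p (n := 0) (m := - p) XG.
rewrite add0r addNr; exact.
Qed.

Lemma tshift_hom0_ex X : exists N : nat, forall p, (N < `|p|)%N -> hom0 (tshift p G) X.
Proof.
have [_ [N XN]] := hft G X; exists N => p Np.
have XG : hom0 G (tshift (- p) X) by apply: XN; rewrite abszN.
have := @hom0_tshift _ _ p 0 (- p) G X; rewrite add0r addNr => -[H _].
exact: (H XG).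
Qed.

Lemma kill_degree P X p : P p -> exists Y (u : hom D X Y),
  cellular P u /\ forall f : hom D (tshift p G) X, u \c f = 0.
Proof.
move=> Pp; have [n [e eP]] := fin_dim_tshift p X.
suff /(_ n)[Y [u [uP ue]]] m : exists Y (u : hom D X Y),
    cellular P u /\ forall i : 'I_n, (i < m)%N -> u \c e i = 0.
  exists Y, u; split=> // f; have [c ->] := eP f.
  by rewrite compm_sum big1// => i _; rewrite ue// scaler0.
elim: m => [|m [Y [u [uP ue]]]].
  by exists X, (idm X); split; [exact: cellular_id|].
have [mn|nm] := ltnP m n; last first.
  by exists Y, u; split=> // i im; apply: ue; exact: leq_trans nm.
have [Z [g [h fgh]]] := exact_cone (u \c e (Ordinal mn)).
exists Z, (g \c u); split=> [|i]; first exact: cellular_step Pp uP fgh.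
rewrite ltnS leq_eqVlt => /orP[/eqP im|im]; last by rewrite -compA ue// compm0.
have -> : i = Ordinal mn by exact: val_inj.
by rewrite -compA; exact: exact_comp0 fgh.
Qed.

Lemma ghost_cellular P X : supp_in P X -> exists Y (u : hom D X Y),
  cellular P u /\ ghost G u.
Proof.
move=> XP; have [N XN] := tshift_hom0_ex X.
(* Outside [-N, N] there are no maps G[p] -> X, so the 2N + 1 degrees in this window are treated one
   at a time. New maps into Y may appear, but only those coming from X have to die. *)
suff [Y [u [uP uN]]] : exists Y (u : hom D X Y), cellular P u /\
    forall p, P p -> - N%:Z <= p -> p < - N%:Z + (2 * N + 1)%N%:Z ->
      forall f : hom D (tshift p G) X, u \c f = 0.
  exists Y, u; split=> // p f.
  have [Pp|Pp] := pselect (P p); last by rewrite (XP _ Pp f) compm0.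
  have [Np|pN] := ltnP N `|p|%N; first by rewrite (XN _ Np f) compm0.
  by apply: uN => //; lia.
elim: (2 * N + 1)%N => [|m [Y [u [uP uN]]]].
  by exists X, (idm X); split=> [|p _]; [exact: cellular_id|lia].
have [Pm|Pm] := pselect (P (- N%:Z + m%:Z)); last first.
  exists Y, u; split=> // p Pp Np pN; apply: uN => //.
  by rewrite lt_neqAle (_ : _ <= _) ?andbT; [apply: contra_notN Pm => /eqP <-|lia].
have [Z [v [vP vm]]] := kill_degree Y Pm.
exists Z, (v \c u); split; first exact: cellular_comp.
move=> p Pp Np pN f; have [pm|pm] := eqVneq p (- N%:Z + m%:Z).
  by move: f; rewrite pm => f; rewrite -compA.
rewrite -compA uN ?compm0// lt_neqAle pm /=; lia.
Qed.

Lemma nghost_cellular : exists b : nat, forall n P X, supp_in P X ->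
  exists Y (u : hom D X Y),
    cellular (fun q => exists2 p, P p & (`|(q - p)%R| <= n * b)%N) u /\ nghost G n u.
Proof.
(* Hom(G[q], G[p + 1]) vanishes unless q lies within N of p + 1, so each universal ghost enlarges
   the range of degrees by at most N + 1. *)
have [N GN] := tshift_hom0_ex G; exists (N + 1)%N => n.
elim: n => [|n IH] P X XP; first by exists X, (idm X); split=> //; exact: cellular_id.
have [Y [u [uP ug]]] := ghost_cellular XP.
have [|Z [v [vn vg]]] := IH (fun q => exists2 p, P p & (`|(q - p)%R| <= N + 1)%N) Y.
  apply: (cellular_supp _ uP) => [p q Pp Qq|p Qp].
    have := @hom0_tshift _ _ (p + 1) (q - (p + 1)) 0 G G.
    rewrite subrK add0r => -[H _]; apply: H; apply: GN.
    by rewrite ltnNge; apply: contra_notN Qq => ?; exists p => //; lia.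
  by apply: XP => Pp; apply: Qp; exists p => //; lia.
exists Z, (v \c u); split; last by exists Y, u, v.
apply: cellular_comp; last first.
  by apply: cellular_sub uP => p Pp; exists p => //; lia.
apply: cellular_sub vn => q [p [r Pr rp] qp]; exists r => //; lia.
Qed.

End Cells.

(** * Bounds on exact functors, and the range of Hom(G[p], E) *)

Section Bounds.
Variables (k : fieldType) (D : triangulated k) (G : D).
Implicit Types (X Y Z E : D) (p q t a : int).
Hypotheses (hft : finite_type D) (hsat : saturated D) (Ggen : split_generator G).

Lemma cellular_vanishing : exists C : int, forall P E, supp_in G P E ->
  exists X (u : hom D E X),
    cellular G (fun q => exists2 p, P p & `|q - p| <= C) u /\ u = 0.
Proof.
have [n nP] := saturated_ghost_nilpotent hsat Ggen.
have [b bP] := nghost_cellular G hft.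
exists (n * b)%N => P E EP; have [X [u [uP un]]] := bP n P E EP.
exists X, u; split; last exact: nP.
by apply: cellular_sub uP => q [p Pp qp]; exists p => //; lia.
Qed.

Lemma cellular_mono (F : exact_functor D D) P X Y W (u : hom D X Y) :
  cellular G P u -> (forall p, P p -> hom0 W (F (tshift p G))) ->
  forall w : hom D W (F X), fhom F u \c w = 0 -> w = 0.
Proof.
move=> uP WP; elim: uP => {X Y u} [X w|X Y Z p u f g h Pp _ IH fgh w].
  by rewrite fhom1 comp1m.
rewrite fhom_comp -compA => guw; apply: IH.
have [v ->] := exact_lift (efun_exact F fgh) guw.
by rewrite (WP _ Pp v) compm0.
Qed.

Lemma cellular_epi (F : exact_functor D D) P X Y W (u : hom D X Y) :
  cellular G P u -> (forall p, P p -> hom0 (F (tshift p G)) W) ->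
  forall w : hom D (F X) W, exists v, w = v \c fhom F u.
Proof.
move=> uP WP; elim: uP => {X Y u} [X w|X Y Z p u f g h Pp _ IH fgh w].
  by exists w; rewrite fhom1 compm1.
have [v ->] := IH w.
have [c ->] := exact_extend (efun_exact F fgh) (WP _ Pp (v \c fhom F f)).
by exists c; rewrite fhom_comp compA.
Qed.

(** A cellular map that is zero is injective, resp. surjective, on the relevant Hom groups, which
    must then vanish. [C] is chosen before [F], so one constant serves all powers of a functor. *)
Lemma exact_functor_bounds : exists C : int,
  forall (F : exact_functor D D) A E t a,
    [/\ (forall p, a < p -> hom0 (tshift p G) E) -> hom_above A t (F G) ->
          hom_above A (t + a + C) (F E)
      & (forall p, p < a -> hom0 (tshift p G) E) -> hom_below A t (F G) ->
          hom_below A (t + a - C) (F E)].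
Proof.
have [C CP] := cellular_vanishing; exists C => F A E t a; split=> Ea Ft B q AB qt.
  have [|X [u [uP u0]]] := CP (fun p => p <= a) E.
    by move=> p /negP; rewrite -ltNge; exact: Ea.
  move=> w; apply: (cellular_mono (F := F) uP); last by rewrite u0 linear0 comp0m.
  move=> p [p' p'a pp']; apply: (hom0_iso (isomorphic_refl _)
    (isomorphic_sym (exact_functor_tshift _ _ _))).
  have := @hom0_tshift _ _ p (q - p) 0 B (F G); rewrite subrK add0r => -[H _].
  by apply: H; apply: Ft => //; lia.
have [|X [u [uP u0]]] := CP (fun p => a <= p) E.
  by move=> p /negP; rewrite -ltNge; exact: Ea.
move=> w; have [|v ->] := cellular_epi (F := F) (W := tshift q B) uP _ w; last first.
  by rewrite u0 linear0 compm0.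
move=> p [p' p'a pp']; apply: (hom0_iso
  (isomorphic_sym (exact_functor_tshift _ _ _)) (isomorphic_refl _)).
have := @hom0_tshift _ _ p 0 (q - p) (F G) B; rewrite subrK add0r => -[H _].
by apply: H; apply: Ft => //; lia.
Qed.

Lemma hom0_of_hearts A s t E : is_heart A -> hom_below A s G -> hom_above A t E ->
  forall p, t - s < p -> hom0 (tshift p G) E.
Proof.
move=> hA Gs Et p ps; apply: (hom_below_above hA (s := s + p) _ Et); last by lia.
move=> B q AB qs; have := @hom0_tshift _ _ p 0 (q - p) G B.
by rewrite subrK add0r => -[H _]; apply: H; apply: Gs => //; lia.
Qed.

Lemma serre_hom0 (S : linfunctor D D) X Y : is_serre S ->
  hom0 Y (S X) -> hom0 X Y.
Proof.
move=> [_ [eta [_ eta_ex _]]] YX f.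
have [f' [_ f'u]] := eta_ex X Y (eta X Y f).
have zE (g g' : {scalar hom D Y (S X)}) : g =1 g'.
  by move=> x; rewrite (YX x) !linear0.
by rewrite (f'u f)// (f'u 0).
Qed.

(** The shift is first moved onto E: Hom(G[p], E) = Hom(G, E[-p]), which is dual to Hom(E[-p], S G)
    = Hom(E, (S G)[p]). *)
Lemma hom0_of_serre (S : linfunctor D D) A s t E : is_serre S -> is_heart A ->
  hom_above A t (S G) -> hom_below A s E ->
  forall p, p < s - t -> hom0 (tshift p G) E.
Proof.
move=> hS hA SGt Es p ps.
have Ep : hom0 E (tshift p (S G)).
  apply: (hom_below_above hA (t := t + p) Es); last by lia.
  move=> B q AB qs; have := @hom0_tshift _ _ p (q - p) 0 B (S G).
  by rewrite subrK add0r => -[H _]; apply: H; apply: SGt => //; lia.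
have := @hom0_tshift _ _ (- p) 0 p E (S G); rewrite subrr add0r => -[/(_ Ep) H _].
have := @hom0_tshift _ _ p 0 (- p) G E; rewrite add0r addNr => -[H' _].
by apply: H'; apply: serre_hom0 hS H.
Qed.

End Bounds.

(** * Fekete's subadditivity lemma *)

Section Fekete.
Variable R : realType.

Lemma cvg_div_nat (M eps : R) : 0 < eps -> \forall n \near \oo, M / n%:R <= eps.
Proof.
move=> e0; near=> n.
have n0 : (0 < n%:R :> R) by rewrite ltr0n; near: n; exact: nbhs_infty_gt.
rewrite ler_pdivrMr// mulrC -ler_pdivrMr//.
by near: n; exact: nbhs_infty_ger.
Unshelve. all: by end_near. Qed.

Lemma cvg_bounded_difference (u v : nat -> int) (M : int) (l : R) :
  (forall n, `|u n - v n| <= M) ->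
  (fun n => (u n)%:~R / n%:R : R) @ \oo --> l ->
  (fun n => (v n)%:~R / n%:R : R) @ \oo --> l.
Proof.
move=> uv /cvgrPdist_le ul; apply/cvgrPdist_le => e e0; near=> n.
have -> : l - (v n)%:~R / n%:R =
    (l - (u n)%:~R / n%:R) + (u n - v n)%:~R / n%:R :> R.
  by rewrite intrB mulrBl addrA subrK.
rewrite (splitr e); apply: (le_trans (ler_normD _ _)); apply: lerD.
  by near: n; apply: ul; rewrite divr_gt0.
rewrite normrM normfV [X in _ / X]ger0_norm// -intr_norm.
apply: (@le_trans _ _ (M%:~R / n%:R)).
  by rewrite ler_wpM2r ?invr_ge0// ler_int.
by near: n; apply: cvg_div_nat; rewrite divr_gt0.
Unshelve. all: by end_near. Qed.

Lemma fekete (b : nat -> R) (K : R) : (forall m n, b (m + n)%N <= b m + b n) ->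
  (forall n, - K * n%:R <= b n) ->
  exists l : R, (fun n => b n / n%:R) @ \oo --> l.
Proof.
move=> bD bK; pose E := [set b n / n%:R | n in [set n | (0 < n)%N]].
have n_gt0 n : (0 < n)%N -> (0 < n%:R :> R) by rewrite ltr0n.
have Elb : lbound E (- K).
  by move=> _ [n n0 <-]; rewrite ler_pdivlMr ?n_gt0.
have Einf : has_inf E by split; [exists (b 1%N / 1%:R), 1%N|exists (- K)].
exists (inf E); apply/cvgrPdist_le => e e0.
have e20 : 0 < e / 2 by rewrite divr_gt0.
have [_ [N N0 <-] bN] := inf_adherent e20 Einf.
have {}bN := ltW bN.
(* Writing n = qN + r gives b n <= q b N + b r. The sum bounds b r, and |b N| pays for replacing q
   by n / N. *)
pose M := \sum_(r < N) `|b r| + `|b N|.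
have bM n : b n <= (n %/ N)%N%:R * b N + \sum_(r < N) `|b r|.
  rewrite {1}(divn_eq n N); have bqr q r : b (q * N + r)%N <= q%:R * b N + b r.
    elim: q => [|q IH]; first by rewrite mul0r add0r.
    rewrite mulSn -addnA; apply: (le_trans (bD _ _)).
    by rewrite -natr1 mulrDl mul1r addrAC [leRHS]addrC lerD2l.
  apply: (le_trans (bqr _ _)); rewrite lerD2l.
  have rN : (n %% N < N)%N by rewrite ltn_mod.
  rewrite (bigD1 (Ordinal rN)) //=; apply: (le_trans (ler_norm _)).
  by rewrite lerDl sumr_ge0.
near=> n.
have n0 : (0 < n)%N by near: n; exact: nbhs_infty_gt.
have lbn : inf E <= b n / n%:R by apply: ge_inf; [exists (- K)|exists n].
rewrite distrC ger0_norm ?subr_ge0// lerBlDl.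
have -> : inf E + e = (inf E + e / 2) + e / 2 by rewrite -addrA -splitr.
apply: (@le_trans _ _ (b N / N%:R + M / n%:R)); last first.
  apply: lerD => //; near: n; apply: cvg_div_nat; rewrite divr_gt0//.
rewrite ler_pdivrMr ?n_gt0// mulrDl divfK ?gt_eqF ?n_gt0//.
apply: (le_trans (bM n)); rewrite /M [leLHS]addrC [leRHS]addrCA lerD2l.
have nE : n%:R = (n %/ N)%N%:R * N%:R + (n %% N)%N%:R :> R.
  by rewrite -natrM -natrD -divn_eq.
rewrite nE mulrDr [_ / _ * (_ * _)]mulrCA divfK ?gt_eqF ?n_gt0// -addrA lerDl.
rewrite -lerBlDl sub0r.
apply: le_trans (ler_norm _) _; rewrite normrN -mulrA normrM ler_piMr//.
rewrite ger0_norm ?mulr_ge0// mulrC ler_pdivrMr ?n_gt0// mul1r ler_nat.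
by rewrite ltnW// ltn_mod.
Unshelve. all: by end_near. Qed.

End Fekete.
Lemma fekete_int (R : realType) (a : nat -> int) (C K : int) :
  (forall m n, a (m + n)%N <= a m + a n + C) ->
  (forall n, - (K * (n%:Z + 1)) <= a n) ->
  exists l : R, (fun n => (a n)%:~R / n%:R : R) @ \oo --> l.
Proof.
(* Adding C makes the sequence subadditive. The factor 2 covers n + 1 <= 2n for n > 0; for n = 0,
   subadditivity itself gives a 0 + C >= 0. *)
move=> aD aK; have [m n|n|l bl] :=
    @fekete R (fun n => (a n + C)%:~R) (2 * `|K| + `|C|)%:~R.
- by rewrite -intrD ler_int; have := aD m n; lia.
- rewrite -intrN -[n%:R]/(n%:~R) -intrM ler_int.
  case: n => [|n]; first by have := aD 0%N 0%N; rewrite addn0; lia.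
  have := aK n.+1; nia.
exists l; apply: cvg_bounded_difference bl => n.
by rewrite addrAC subrr add0r.
Qed.

(** * Growth of phi+ and phi- along the powers of F *)

Section ShiftingNumbers.
Variables (k : fieldType) (D : triangulated k).
Hypotheses (hsat : saturated D) (hft : finite_type D).
Variables (F : exact_functor D D).
Hypothesis (hF : not_virtually_zero F).
Implicit Types (G E : D) (A : D -> Prop).

Let tshift_hom0_bound G E : exists N : nat, forall p : int,
  (N%:Z < p \/ p < - N%:Z) -> hom0 (tshift p G) E.
Proof.
have [N GN] := tshift_hom0_ex G hft E; exists N => p Np.
by apply: GN; lia.
Qed.

Lemma fpowD m n E : fpow F (m + n) E = fpow F m (fpow F n E).
Proof. exact: iterD. Qed.

Lemma fpow_bounds G : split_generator G -> exists C : int, forall m A E t a,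
    [/\ (forall p, a < p -> hom0 (tshift p G) E) -> hom_above A t (fpow F m G) ->
          hom_above A (t + a + C) (fpow F m E)
      & (forall p, p < a -> hom0 (tshift p G) E) -> hom_below A t (fpow F m G) ->
          hom_below A (t + a - C) (fpow F m E)].
Proof.
move=> Gg; have [C CP] := exact_functor_bounds hft hsat Gg; exists C => m A E t a.
by have := CP (exact_iter F m) A E t a; rewrite !exact_iterE.
Qed.

(** If F^m G were zero, the uniform bounds would push phi+(F^m E) below every integer for each E, so
    F^m would be the zero functor. *)
Lemma fpow_nonzero A G n : is_heart A -> split_generator G -> ~ is_zero (fpow F n G).
Proof.
move=> hA Gg; suff nz m : (0 < m)%N -> ~ is_zero (fpow F m G).
  case: n => [|n] G0; last exact: nz G0.
  by apply: (nz 1%N) => //; exact: (functor_is_zero F).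
move=> m0 G0; apply: (hF m0) => E; apply: contrapT => E0.
have [C CP] := fpow_bounds Gg; have [N GN] := tshift_hom0_bound G E.
(* Every t is admissible for the zero object F^m G; this one makes the resulting bound equal to
   phi+(F^m E) - 1. *)
have [above _] := CP m A E (phi_plus A (fpow F m E) - N%:Z - C - 1) N.
have/(phi_plusP hA E0) : hom_above A
    (phi_plus A (fpow F m E) - N%:Z - C - 1 + N%:Z + C) (fpow F m E).
  by apply: above; [move=> p Np; apply: GN; left|exact: is_zero_hom_above].
lia.
Qed.

Lemma phi_plus_fpow_le A G : is_heart A -> split_generator G -> forall E,
  exists M : int, forall n, ~ is_zero (fpow F n E) ->
    phi_plus A (fpow F n E) <= phi_plus A (fpow F n G) + M.
Proof.
move=> hA Gg E; have [C CP] := fpow_bounds Gg; have [N GN] := tshift_hom0_bound G E.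
exists (N%:Z + C) => n En; apply/(phi_plusP hA En); rewrite addrA.
have [+ _] := CP n A E (phi_plus A (fpow F n G)) N; apply.
  by move=> p Np; apply: GN; left.
by apply/(phi_plusP hA); first exact: fpow_nonzero hA Gg.
Qed.

Lemma phi_minus_fpow_ge A G : is_heart A -> split_generator G -> forall E,
  exists M : int, forall n, ~ is_zero (fpow F n E) ->
    phi_minus A (fpow F n G) - M <= phi_minus A (fpow F n E).
Proof.
move=> hA Gg E; have [C CP] := fpow_bounds Gg; have [N GN] := tshift_hom0_bound G E.
exists (N%:Z + C) => n En; apply/(phi_minusP hA En); rewrite opprD addrA.
have [_] := CP n A E (phi_minus A (fpow F n G)) (- N%:Z); apply.
  by move=> p Np; apply: GN; right.
by apply/(phi_minusP hA); first exact: fpow_nonzero hA Gg.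
Qed.

(* The case [m = 0] compares two hearts. *)
Lemma phi_plus_fpow_add A A' G : is_heart A -> is_heart A' -> split_generator G ->
  exists M : int, forall m n,
    phi_plus A' (fpow F (m + n) G) <=
      phi_plus A' (fpow F m G) + phi_plus A (fpow F n G) + M.
Proof.
move=> hA hA' Gg; have nz m B hB := @fpow_nonzero B G m hB Gg.
have [C CP] := fpow_bounds Gg; have [s Gs] := hom_below_ex hA G.
exists (C - s) => m n; apply/(phi_plusP hA' (nz _ _ hA')); rewrite fpowD.
have [+ _] := CP m A' (fpow F n G) (phi_plus A' (fpow F m G))
  (phi_plus A (fpow F n G) - s).
have -> x y : x + y + (C - s) = x + (y - s) + C by lia.
apply.
  by apply: (hom0_of_hearts hA Gs); apply/(phi_plusP hA (nz _ _ hA)).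
by apply/(phi_plusP hA' (nz _ _ hA')).
Qed.

Lemma phi_minus_fpow_add A A' G : has_serre D -> is_heart A -> is_heart A' ->
  split_generator G -> exists M : int, forall m n,
    phi_minus A' (fpow F m G) + phi_minus A (fpow F n G) - M <=
      phi_minus A' (fpow F (m + n) G).
Proof.
move=> [S hS] hA hA' Gg; have nz m B hB := @fpow_nonzero B G m hB Gg.
have [C CP] := fpow_bounds Gg; have [s Gs] := hom_above_ex hA (S G).
exists (C + s) => m n; apply/(phi_minusP hA' (nz _ _ hA')); rewrite fpowD.
have [_] := CP m A' (fpow F n G) (phi_minus A' (fpow F m G))
  (phi_minus A (fpow F n G) - s).
have -> x y : x + y - (C + s) = x + (y - s) - C by lia.
apply.
  by apply: (hom0_of_serre hS hA Gs); apply/(phi_minusP hA (nz _ _ hA)).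
by apply/(phi_minusP hA' (nz _ _ hA')).
Qed.

(** Comparison with E = F G shows that each application of F lowers phi- by at most M. As phi- <=
    phi+, this supplies the lower bound in Fekete's lemma for phi+. *)
Lemma phi_minus_fpow_linear A G : is_heart A -> split_generator G ->
  exists K : int, forall n, - (K * (n%:Z + 1)) <= phi_minus A (fpow F n G).
Proof.
move=> hA Gg; have [M MP] := phi_minus_fpow_ge hA Gg (F G).
exists (`|M| + `|phi_minus A G|); elim=> [|n IH]; first by rewrite /=; lia.
have := MP n; rewrite -[F G]/(fpow F 1 G) -fpowD addn1.
by move=> /(_ (fpow_nonzero hA Gg)); lia.
Qed.

Lemma phi_plus_fpow_linear A G : is_heart A -> split_generator G ->
  exists K : int, forall n, phi_plus A (fpow F n G) <= K * (n%:Z + 1).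
Proof.
move=> hA Gg; have [M MP] := phi_plus_fpow_le hA Gg (F G).
exists (`|M| + `|phi_plus A G|); elim=> [|n IH]; first by rewrite /=; lia.
have := MP n; rewrite -[F G]/(fpow F 1 G) -fpowD addn1.
by move=> /(_ (fpow_nonzero hA Gg)); lia.
Qed.

Lemma phi_plus_fpow_cvg (R : realType) A G : is_heart A -> split_generator G ->
  exists l : R, (fun n => (phi_plus A (fpow F n G))%:~R / n%:R : R) @ \oo --> l.
Proof.
move=> hA Gg; have [M MP] := phi_plus_fpow_add hA hA Gg.
have [K KP] := phi_minus_fpow_linear hA Gg.
apply: fekete_int MP _ => n; apply: le_trans (KP n) _.
exact: phi_minus_le_plus (fpow_nonzero hA Gg).
Qed.

Lemma phi_minus_fpow_cvg (R : realType) A G : has_serre D -> is_heart A ->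
  split_generator G ->
  exists l : R, (fun n => (phi_minus A (fpow F n G))%:~R / n%:R : R) @ \oo --> l.
Proof.
move=> hS hA Gg; have [M MP] := phi_minus_fpow_add hS hA hA Gg.
have [K KP] := phi_plus_fpow_linear hA Gg.
have [|n|l bl] := @fekete_int R (fun n => - phi_minus A (fpow F n G)) M K.
- by move=> m n; have := MP m n; lia.
- have := KP n; have := phi_minus_le_plus hA (@fpow_nonzero _ _ n hA Gg); lia.
exists (- l).
suff -> : (fun n => (phi_minus A (fpow F n G))%:~R / n%:R) =
  - (fun n => (- phi_minus A (fpow F n G))%:~R / n%:R) :> (nat -> R) by exact: cvgN.
by apply/funext => n; rewrite -[RHS]/(- (_ / _)) intrN mulNr opprK.
Qed.

(** First G' is exchanged for G within the heart A', then A' for A by the case m = 0 of almost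
    subadditivity, which contributes phi+(G). *)
Lemma phi_plus_fpow_compare A A' G G' : is_heart A -> is_heart A' ->
  split_generator G -> split_generator G' -> exists M : int, forall n,
    phi_plus A' (fpow F n G') <= phi_plus A (fpow F n G) + M.
Proof.
move=> hA hA' Gg Gg'; have [M MP] := phi_plus_fpow_le hA' Gg G'.
have [M' MP'] := phi_plus_fpow_add hA hA' Gg.
exists (M + phi_plus A' G + M') => n.
have := MP n (fpow_nonzero hA' Gg'); have := MP' 0%N n; rewrite add0n /=; lia.
Qed.

Lemma phi_minus_fpow_compare A A' G G' : has_serre D -> is_heart A -> is_heart A' ->
  split_generator G -> split_generator G' -> exists M : int, forall n,
    phi_minus A (fpow F n G) <= phi_minus A' (fpow F n G') + M.
Proof.
move=> hS hA hA' Gg Gg'; have [M MP] := phi_minus_fpow_ge hA' Gg G'.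
have [M' MP'] := phi_minus_fpow_add hS hA hA' Gg.
exists (M - phi_minus A' G + M') => n.
have := MP n (fpow_nonzero hA' Gg'); have := MP' 0%N n; rewrite add0n /=; lia.
Qed.

Lemma cvg_of_comparison (R : realType) (phi : (D -> Prop) -> D -> int) :
  (forall A G, is_heart A -> split_generator G ->
     exists l : R, (fun n => (phi A (fpow F n G))%:~R / n%:R : R) @ \oo --> l) ->
  (forall A A' G G', is_heart A -> is_heart A' -> split_generator G ->
     split_generator G' -> exists M : int, forall n,
     phi A (fpow F n G) <= phi A' (fpow F n G') + M) ->
  exists l : R, forall (G : D) (A : D -> Prop), split_generator G -> is_heart A ->
     (fun n : nat => (phi A (fpow F n G))%:~R / n%:R : R) @ \oo --> l.
Proof.
move=> phi_cvg phi_cmp.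
(* The limit has to be fixed before G and A. If no such pair exists, the value 0 works vacuously. *)
have [[G [A [Gg hA]]]|none] :=
  pselect (exists G A, split_generator G /\ is_heart A); last first.
  by exists 0 => G A Gg hA; case: none; exists G, A.
have [l Gl] := phi_cvg A G hA Gg; exists l => G' A' Gg' hA'.
have [M MP] := phi_cmp A A' G G' hA hA' Gg Gg'.
have [M' MP'] := phi_cmp A' A G' G hA' hA Gg' Gg.
apply: (cvg_bounded_difference (M := `|M| + `|M'|)) Gl => n.
by have := MP n; have := MP' n; lia.
Qed.

End ShiftingNumbers.

Theorem theorem1p1 (k : fieldType) (R : realType) (D : triangulated k)
    (hsat : saturated D) (hft : finite_type D)
    (F : exact_functor D D) (hF : not_virtually_zero F) :
  (exists l : R, forall (G : D) (A : D -> Prop),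
     split_generator G -> is_heart A ->
     (fun n : nat => (phi_plus A (fpow F n G))%:~R / n%:R : R) @ \oo --> l)
  /\
  (has_serre D ->
   exists l : R, forall (G : D) (A : D -> Prop),
     split_generator G -> is_heart A ->
     (fun n : nat => (phi_minus A (fpow F n G))%:~R / n%:R : R) @ \oo --> l).
Proof.
split=> [|hS]; apply: cvg_of_comparison => A.
- by move=> G; exact: phi_plus_fpow_cvg.
- by move=> A' G G' hA hA' Gg Gg'; exact: phi_plus_fpow_compare.
- by move=> G; exact: phi_minus_fpow_cvg.
- by move=> A' G G'; exact: phi_minus_fpow_compare.
Qed.
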